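(* Let $d\ge 1$ and $n\ge 0$ be integers, and let $F:\mathcal{S}\to\mathbb{R}$ be a rotation-invariant function on the space $\mathcal{S}$ of real symmetric $d\times d$ matrices. If the restriction of $F$ to the subspace $\mathcal{D}\subset\mathcal{S}$ of diagonal matrices is $C^n$, then $F$ is $C^n$ on $\mathcal{S}$.
   Context: $\mathcal{S}$ is the vector space of real $d\times d$ symmetric matrices, $\mathcal{D}\subset\mathcal{S}$ is the subspace of diagonal matrices, and $G$ is the group of $d\times d$ rotation matrices (real orthogonal matrices of determinant $1$). A function $F:\mathcal{S}\to\mathbb{R}$ is rotation-invariant if $F(gxg^{-1})=F(x)$ for every $x\in\mathcal{S}$ and $g\in G$. $C^0$ means continuous. *)

(* Defs.v *)
From HB Require Import structures.
From mathcomp Require Import all_boot all_order all_algebra.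
From mathcomp Require Import all_classical all_reals all_analysis.

Set Implicit Arguments.
Unset Strict Implicit.
Unset Printing Implicit Defensive.

Import Order.TTheory GRing.Theory Num.Theory.
Import numFieldNormedType.Exports.

Local Open Scope classical_set_scope.
Local Open Scope ring_scope.

(* Intended for finite-dimensional V, where the derivative of f, as a map into
   the space of linear maps V -> W, is C^n iff each of its evaluations
   x |-> 'd f x v is. *)
Fixpoint Cn (R : realType) (V W : normedModType R) (n : nat) (f : V -> W)
    : Prop :=
  match n with
  | 0 => continuous f
  | m.+1 => (forall x : V, differentiable f x) /\
            (forall v : V, Cn m (fun x : V => 'd f x v))
  end.

(* Both subspaces carry the norm of the ambient matrix space (the maximum of the
   absolute values of the entries). *)
Section SymmetricMatrices.
Context (R : realType) (d : nat).

Definition sym_pred : pred 'M[R]_d := fun x => x \is symmetricmx.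

Lemma sym_predE (x : 'M[R]_d) : sym_pred x = (x^T == x).
Proof. by rewrite /sym_pred qualifE /= expr0 scale1r map_mx_id // eq_sym. Qed.

Fact sym_pred_submod : subsemimod_closed sym_pred.
Proof.
split; first split.
- by rewrite -topredE /= sym_predE trmx0.
- move=> x y; rewrite -!topredE /= !sym_predE => /eqP hx /eqP hy.
  by rewrite linearD /= hx hy.
- move=> a x; rewrite -!topredE /= !sym_predE => /eqP hx.
  by rewrite linearZ /= hx.
Qed.

HB.instance Definition _ :=
  GRing.isSubmodClosed.Build R 'M[R]_d sym_pred sym_pred_submod.

Record symmx : Type := SymMx { symval :> 'M[R]_d; _ : sym_pred symval }.

HB.instance Definition _ := [isSub for symval].
HB.instance Definition _ := [Choice of symmx by <:].
HB.instance Definition _ := [SubChoice_isSubLmodule of symmx by <:].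

Definition sym_norm (x : symmx) : R := `|symval x|.

Fact sym_normD (x y : symmx) : sym_norm (x + y) <= sym_norm x + sym_norm y.
Proof. exact: ler_normD. Qed.

Fact sym_normZ (a : R) (x : symmx) : sym_norm (a *: x) = `|a| * sym_norm x.
Proof. exact: normrZ. Qed.

Fact sym_norm0_eq0 (x : symmx) : sym_norm x = 0 -> x = 0.
Proof. by move=> /normr0_eq0 x0; apply: val_inj. Qed.

HB.instance Definition _ :=
  @Lmodule_isNormed.Build R symmx sym_norm sym_normD sym_normZ sym_norm0_eq0.

Definition diag_pred : pred symmx := fun x => is_diag_mx (symval x).

Fact diag_pred_submod : subsemimod_closed diag_pred.
Proof.
split; first split.
- exact: mx0_is_diag.
- move=> x y /is_diag_mxP hx /is_diag_mxP hy; apply/is_diag_mxP => i j ij.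
  by rewrite mxE hx // hy // addr0.
- move=> a x /is_diag_mxP hx; apply/is_diag_mxP => i j ij.
  by rewrite mxE hx // mulr0.
Qed.

HB.instance Definition _ :=
  GRing.isSubmodClosed.Build R symmx diag_pred diag_pred_submod.

Record diagmx : Type := DiagMx { diagval :> symmx; _ : diag_pred diagval }.

HB.instance Definition _ := [isSub for diagval].
HB.instance Definition _ := [Choice of diagmx by <:].
HB.instance Definition _ := [SubChoice_isSubLmodule of diagmx by <:].

Definition diag_norm (x : diagmx) : R := `|diagval x|.

Fact diag_normD (x y : diagmx) : diag_norm (x + y) <= diag_norm x + diag_norm y.
Proof. exact: ler_normD. Qed.

Fact diag_normZ (a : R) (x : diagmx) : diag_norm (a *: x) = `|a| * diag_norm x.
Proof. exact: normrZ. Qed.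

Fact diag_norm0_eq0 (x : diagmx) : diag_norm x = 0 -> x = 0.
Proof. by move=> /normr0_eq0 x0; apply: val_inj. Qed.

HB.instance Definition _ :=
  @Lmodule_isNormed.Build R diagmx diag_norm diag_normD diag_normZ
    diag_norm0_eq0.

Definition is_rotation (g : 'M[R]_d) : bool :=
  (g *m g^T == 1%:M) && (\det g == 1).

Fact sym_pred_conj (g : 'M[R]_d) (x : symmx) :
  is_rotation g -> sym_pred (g *m symval x *m invmx g).
Proof.
move=> /andP[/eqP gg _]; case: x => x /=; rewrite !sym_predE => /eqP hx.
have ug : g \in unitmx by have [] := mulmx1_unit gg.
have -> : invmx g = g^T by rewrite -[RHS](mulKmx ug) gg mulmx1.
by rewrite !trmx_mul trmxK hx mulmxA.
Qed.

Definition sym_conj (g : 'M[R]_d) (hg : is_rotation g) (x : symmx) : symmx :=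
  SymMx (sym_pred_conj x hg).

Definition rotation_invariant (F : symmx -> R) : Prop :=
  forall (x : symmx) (g : 'M[R]_d) (hg : is_rotation g),
    F (sym_conj hg x) = F x.

End SymmetricMatrices.

(* Main.v *)
Require Import Defs.
From HB Require Import structures.
From mathcomp Require Import all_boot all_order all_algebra.
From mathcomp Require Import all_classical all_reals all_analysis.
From mathcomp Require Import perm ring lra.
Import Order.TTheory GRing.Theory Num.Theory.
Import numFieldNormedType.Exports.
Local Open Scope classical_set_scope.
Local Open Scope ring_scope.

Set Implicit Arguments.
Unset Strict Implicit.
Unset Printing Implicit Defensive.

(**
  The proof combines an a priori estimate with density of polynomials.

  Let P be smooth and rotation-invariant.  Differentiating the invariance along
  the rotations of the plane (i, j) gives, at a diagonal matrix u, an identity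
  2 (u_i - u_j) D_b Q (u) = N (u), where b is the symmetric off-diagonal
  direction (i, j), Q is an iterated derivative of P and N is a sum of
  derivatives of P of the same order as Q.  Since N vanishes on the wall
  u_i = u_j, dividing by u_i - u_j costs exactly one derivative of N in a
  diagonal direction.  Trading off-diagonal directions for diagonal ones in this
  way bounds all derivatives of order q of P by those of its restriction to the
  diagonal matrices, on comparable bounded sets and with a constant depending
  only on q and d; the spectral theorem carries the bound from diagonal to all
  symmetric matrices.

  The restriction f of F is invariant under permutations of the coordinates.  It
  is a C^n limit of polynomials (Bernstein operators, one coordinate at a time),
  which may be taken symmetric, and every symmetric polynomial is the
  restriction of a rotation-invariant polynomial on symmetric matrices.  By the
  estimate these extensions are Cauchy in C^n, and their limit is F.
*)

(** * Calculus of directional derivatives *)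

(** The obstacle is the set of matrices with a repeated eigenvalue. Near it a diagonalizing rotation
    need not depend even continuously on the matrix, so [F] cannot be differentiated through x = g u
    g^-1. Nor is [F] known to be differentiable anywhere, so the identities behind the estimate make
    no sense for [F]. They are therefore established for smooth invariant functions and applied only
    to differences of approximants; [F] enters at the very end, as a pointwise limit. Polynomials
    are the right approximants because their invariant extensions have to be smooth across the
    walls, and an extension that is polynomial in the matrix entries is so automatically. The norms
    are maximum norms, so bounded sets are cubes. The projection of u onto a wall averages two
    coordinates and does not leave the cube, which is why division by u_i - u_j needs no larger set.
    Only conjugation by a rotation enlarges cubes, by a factor depending on d alone. *)

Section DirectionalDerivatives.
Context (R : realType) (V : normedModType R).
Implicit Types (f g : V -> R) (x v w : V).

Definition dird v f : V -> R := fun x => 'd f x v.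

Definition diffable f := forall x, differentiable f x.

Lemma diff_intro f x (df : {linear V -> R}) : continuous df ->
  (forall e : R, 0 < e -> exists2 r : R, 0 < r &
     forall h : V, `|h| <= r -> `|f (x + h) - f x - df h| <= e * `|h|) ->
  differentiable f x /\ forall v, 'd f x v = df v.
Proof.
move=> cdf H.
have E : f \o shift x = cst (f x) + df +o_ 0 id.
  apply/eqaddoP => _/posnumP[e].
  have [r r0 Hr] := H e%:num [elaborate gt0 e].
  near=> h.
  rewrite /= !fctE /= opprD addrA [h + x]addrC; apply: Hr.
  near: h.
  apply/nbhs_ballP; exists r => //= h.
  by rewrite -ball_normE /= sub0r normrN => /ltW.
have D := diff_unique cdf E.
split; last by move=> v; rewrite D.
apply/diff_locallyP; rewrite D; split => //.
Unshelve. all: by end_near. Qed.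

Lemma is_derive_line f x v (t : R) : differentiable f (x + t *: v) ->
  is_derive t 1 (fun s : R => f (x + s *: v)) (dird v f (x + t *: v)).
Proof.
move=> df.
have dl : is_diff t (fun s : R => x + s *: v) (fun s : R => s *: v).
  by apply: is_diff_eq; rewrite add0r.
have D : differentiable (f \o (fun s : R => x + s *: v)) t.
  by apply: differentiable_comp.
split; first exact/derivable1_diffP.
rewrite deriveE // diff_comp //= diff_val /= scale1r //.
Qed.

Lemma mvt_line f x v : diffable f ->
  exists2 t : R, 0 <= t <= 1 & f (x + v) - f x = dird v f (x + t *: v).
Proof.
move=> df.
have [||t] := @MVT_segment R (fun s : R => f (x + s *: v))
    (fun s => dird v f (x + s *: v)) 0 1 ler01.
- by move=> t _; apply: is_derive_line.
- apply: continuous_subspaceT => t.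
  apply: differentiable_continuous; apply/derivable1_diffP.
  by have [] := is_derive_line (df (x + t *: v)).
rewrite in_itv /= => t01.
rewrite scale1r scale0r addr0 subr0 mulr1 => E.
by exists t.
Qed.

Lemma Cn_diffable n f : Cn n.+1 f -> diffable f.
Proof. by case. Qed.

Lemma Cn_dird n f v : Cn n.+1 f -> Cn n (dird v f).
Proof. by case=> _; apply. Qed.

Lemma CnW n f : Cn n.+1 f -> Cn n f.
Proof.
elim: n f => [|n IH] f [df Df].
  by move=> x; apply: differentiable_continuous.
by split=> // v; apply: IH; apply: Df.
Qed.

Lemma Cn_le m n f : (m <= n)%N -> Cn n f -> Cn m f.
Proof.
elim: n => [|n IH]; first by rewrite leqn0 => /eqP ->.
rewrite leq_eqVlt => /predU1P[-> //|mn] /CnW; exact: IH.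
Qed.

Lemma Cn_continuous n f : Cn n f -> continuous f.
Proof. exact: (@Cn_le 0). Qed.

Lemma dird_cst (c : R) v : dird v (fun _ => c) = fun _ => 0.
Proof. by apply/funext => x; rewrite /dird (diff_cst c). Qed.

Lemma Cn_cst n (c : R) : Cn n (fun _ : V => c).
Proof.
elim: n c => [|n IH] c; first exact: cst_continuous.
split=> [x|v]; first exact: differentiable_cst.
by have := dird_cst c v; rewrite /dird => ->.
Qed.

Lemma dirdD f g v : diffable f -> diffable g ->
  dird v (fun x => f x + g x) = fun x => dird v f x + dird v g x.
Proof.
move=> df dg; apply/funext => x; rewrite /dird.
by have := diffD (df x) (dg x); rewrite addrfctE => ->.
Qed.

Lemma dirdM f g v : diffable f -> diffable g ->
  dird v (fun x => f x * g x) = fun x => dird v f x * g x + f x * dird v g x.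
Proof.
move=> df dg; apply/funext => x; rewrite /dird.
have := diffM (df x) (dg x); rewrite mulrfctE => ->.
by rewrite !fctE /= addrC /GRing.scale /= [X in _ = X + _]mulrC.
Qed.

Lemma dirdZ (c : R) f v : diffable f ->
  dird v (fun x => c * f x) = fun x => c * dird v f x.
Proof.
move=> df; have dc : diffable (fun _ : V => c) by move=> x;
  exact: differentiable_cst.
rewrite dirdM //.
by apply/funext => x; have -> := dird_cst c v; rewrite mul0r add0r.
Qed.

Lemma diffableD f g : diffable f -> diffable g -> diffable (fun x => f x + g x).
Proof. by move=> df dg x; apply: differentiableD. Qed.

Lemma diffableM f g : diffable f -> diffable g -> diffable (fun x => f x * g x).
Proof. by move=> df dg x; apply: differentiableM. Qed.

Lemma CnD n f g : Cn n f -> Cn n g -> Cn n (fun x => f x + g x).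
Proof.
elim: n f g => [|n IH] f g; first by move=> cf cg x; apply: cvgD;
  [apply: cf|apply: cg].
move=> [df Df] [dg Dg]; split; first exact: (diffableD df dg).
by move=> v; have := dirdD v df dg; rewrite /dird => ->; apply: IH;
  [apply: Df|apply: Dg].
Qed.

Lemma CnM n f g : Cn n f -> Cn n g -> Cn n (fun x => f x * g x).
Proof.
elim: n f g => [|n IH] f g; first by move=> cf cg x; apply: cvgM;
  [apply: cf|apply: cg].
move=> cf cg; have [df Df] := cf; have [dg Dg] := cg.
split; first exact: (diffableM df dg).
move=> v; have := dirdM v df dg; rewrite /dird => ->; apply: CnD; apply: IH;
  by [apply: Df|apply: Dg|apply: CnW].
Qed.

Lemma CnZ n (c : R) f : Cn n f -> Cn n (fun x => c * f x).
Proof. by apply: CnM; apply: Cn_cst. Qed.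

Lemma CnB n f g : Cn n f -> Cn n g -> Cn n (fun x => f x - g x).
Proof.
move=> cf cg; have := CnD cf (CnZ (-1) cg); congr Cn.
by apply/funext => x; rewrite mulN1r.
Qed.

Lemma Cn_sum n (I : Type) (s : seq I) (P : pred I) (f : I -> V -> R) :
  (forall i, P i -> Cn n (f i)) -> Cn n (fun x => \sum_(i <- s | P i) f i x).
Proof.
move=> H; elim: s => [|i s IH].
  have -> : (fun x => \sum_(i <- [::] | P i) f i x) = fun=> 0.
    by apply/funext => x; rewrite big_nil.
  exact: Cn_cst.
have -> : (fun x => \sum_(j <- i :: s | P j) f j x) =
    fun x => if P i then f i x + \sum_(j <- s | P j) f j x
             else \sum_(j <- s | P j) f j x.
  by apply/funext => x; rewrite big_cons.
by case Pi: (P i) => //; apply: CnD => //; apply: H.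
Qed.

Lemma dird_sum (I : Type) (s : seq I) (P : pred I) (f : I -> V -> R) v :
  (forall i, P i -> diffable (f i)) ->
  dird v (fun x => \sum_(i <- s | P i) f i x) =
    fun x => \sum_(i <- s | P i) dird v (f i) x.
Proof.
move=> H.
suff [_ ->] : diffable (fun x => \sum_(i <- s | P i) f i x) /\
  dird v (fun x => \sum_(i <- s | P i) f i x) =
    fun x => \sum_(i <- s | P i) dird v (f i) x by [].
elim: s => [|i s [IHd IH]].
  have -> : (fun x => \sum_(i <- [::] | P i) f i x) = fun=> 0.
    by apply/funext => x; rewrite big_nil.
  split; first by move=> x; apply: differentiable_cst.
  by rewrite dird_cst; apply/funext => x; rewrite big_nil.
have -> : (fun x => \sum_(j <- i :: s | P j) f j x) =
    fun x => if P i then f i x + \sum_(j <- s | P j) f j x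
             else \sum_(j <- s | P j) f j x.
  by apply/funext => x; rewrite big_cons.
have -> : (fun x => \sum_(j <- i :: s | P j) dird v (f j) x) =
    fun x => if P i then dird v (f i) x + \sum_(j <- s | P j) dird v (f j) x
             else \sum_(j <- s | P j) dird v (f j) x.
  by apply/funext => x; rewrite big_cons.
case Pi: (P i) => //; split; first by apply: diffableD => //; apply: H.
by rewrite dirdD //; [rewrite IH|apply: H].
Qed.

Lemma Cn_lin n (f : {linear V -> R}) : continuous f -> Cn n f.
Proof.
move=> cf; case: n => [//|n]; split=> [x|v].
  exact: linear_differentiable.
have -> : (fun x => 'd f x v) = fun=> f v.
  by apply/funext => x; rewrite diff_lin.
exact: Cn_cst.
Qed.

Lemma dird_lin (f : {linear V -> R}) v : continuous f -> dird v f = fun _ =>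
  f v.
Proof. by move=> cf; apply/funext => x; rewrite /dird diff_lin. Qed.

Lemma dirdDl f v w x : dird (v + w) f x = dird v f x + dird w f x.
Proof. exact: linearD. Qed.

Lemma dirdZl f (c : R) v x : dird (c *: v) f x = c * dird v f x.
Proof. exact: linearZ. Qed.

Lemma dird_suml f (I : Type) (s : seq I) (c : I -> R) (e : I -> V) x :
  dird (\sum_(i <- s) c i *: e i) f x = \sum_(i <- s) c i * dird (e i) f x.
Proof. by rewrite /dird linear_sum; apply: eq_bigr => i _; rewrite linearZ. Qed.

End DirectionalDerivatives.

(** * Composition with affine maps *)

Section AffineComposition.
Context (R : realType) (V W : normedModType R).
Variables (A : V -> W) (L : {linear V -> W}).
Hypothesis cL : continuous L.
Hypothesis A_affine : forall x v, A (x + v) = A x + L v.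

Lemma is_diff_affine x : is_diff x A L.
Proof.
have -> : A = (fun y => A 0 + L y).
  by apply/funext => y; rewrite -A_affine add0r.
have dL : differentiable L x by apply: linear_differentiable.
split; first by apply: differentiableD => //; apply: differentiable_cst.
have := diffD (differentiable_cst (A 0) x) dL.
rewrite addrfctE => ->.
by rewrite (diff_cst (A 0)) diff_lin //; apply/funext => v /=; rewrite add0r.
Qed.

Lemma dird_affine (f : W -> R) v : diffable f ->
  dird v (fun x => f (A x)) = fun x => dird (L v) f (A x).
Proof.
move=> df; apply/funext => x; rewrite /dird.
have dA := is_diff_affine x.
have := diff_comp (@ex_diff _ _ _ _ _ _ _ dA) (df (A x)).
rewrite /comp => ->.
by rewrite [in LHS](@diff_val _ _ _ _ _ _ _ dA).
Qed.

Lemma diffable_affine (f : W -> R) : diffable f -> diffable (fun x => f (A x)).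
Proof.
move=> df x; apply: (@differentiable_comp _ _ _ _ A f) => //.
by have [] := is_diff_affine x.
Qed.

Lemma Cn_affine n (f : W -> R) : Cn n f -> Cn n (fun x => f (A x)).
Proof.
elim: n f => [|n IH] f.
  move=> cf x; apply: (@continuous_comp _ _ _ A f); last exact: cf.
  by apply: differentiable_continuous; have [] := is_diff_affine x.
move=> [df Df]; split; first exact: diffable_affine.
move=> v; have := dird_affine v df; rewrite /dird => ->.
exact: (IH _ (Df (L v))).
Qed.

End AffineComposition.

(** * Limits of C^n functions *)

Lemma linear_le_continuous (R : realType) (V W : normedModType R)
    (f : {linear V -> W}) (K : R) :
  (forall v, `|f v| <= K * `|v|) -> continuous f.
Proof.
move=> H; apply: bounded_linear_continuous.
apply/linear_boundedP; near=> k.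
have Kk : K <= k by near: k; apply: nbhs_pinfty_ge; rewrite num_real.
by move=> v; apply: le_trans (H v) _; apply: ler_wpM2r.
Unshelve. all: by end_near. Qed.

Section FrameLimit.
Context (R : realType) (V : normedModType R) (I : finType).
Variables (b : I -> V) (c : I -> {linear V -> R}).
Hypothesis frame : forall v, v = \sum_i c i v *: b i.
Hypothesis c_le : forall i v, `|c i v| <= `|v|.

Lemma dird_frame f v x : dird v f x = \sum_i c i v * dird (b i) f x.
Proof. by rewrite {1}[v]frame dird_suml. Qed.

Definition comb (a : I -> R) (v : V) : R := \sum_i c i v * a i.

Fact comb_linear a : linear (comb a).
Proof.
move=> k u v; rewrite /comb scaler_sumr -big_split /=; apply: eq_bigr => i _.
by rewrite linearP /= mulrDl scalerAl.
Qed.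

HB.instance Definition _ a :=
  GRing.isLinear.Build R V R _ (comb a) (comb_linear a).

Lemma comb_le a (K : R) v : (forall i, `|a i| <= K) ->
  `|comb a v| <= #|I|%:R * K * `|v|.
Proof.
move=> aK; apply: le_trans (ler_norm_sum _ _ _) _.
rewrite -mulrA mulrC mulr_natr -sumr_const; apply: ler_sum => i _.
by rewrite normrM mulrC; apply: ler_pM.
Qed.

(** The mean value theorem applied to [fN N] on the segment from x to x + h leaves an error linear
    in |h|. Bounding the derivatives against the constants [G i] on a ball around x combines their
    convergence with the continuity of the limit at x. *)
Lemma limit_differentiable (fN : nat -> V -> R) (f : V -> R) (G : I -> R) x :
  (forall N, diffable (fN N)) ->
  (forall i (e : R), 0 < e -> exists2 r : R, 0 < r & \forall N \near \oo,
     forall y, `|y - x| <= r -> `|dird (b i) (fN N) y - G i| <= e) ->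
  (forall y, fN ^~ y @ \oo --> f y) ->
  differentiable f x /\ forall v, 'd f x v = comb G v.
Proof.
move=> dN dG fNf.
apply: (@diff_intro _ _ f x (comb G)).
  apply: (@linear_le_continuous _ _ _ _ (#|I|%:R * \sum_i `|G i|)) => v.
  by apply: comb_le => i; rewrite (bigD1 i) //= lerDl sumr_ge0.
move=> e e0.
(* A derivative along [h] is a sum of [#|I|] frame terms, each allowed the error [e1]; the summand 1
   covers an empty [I]. *)
pose e1 := e / (#|I|%:R + 1).
have K0 : 0 < #|I|%:R + 1 :> R by rewrite ltr_wpDl.
have e10 : 0 < e1 by rewrite divr_gt0.
have [r r0 Hr] : exists2 r : R, 0 < r & forall i, \forall N \near \oo,
     forall y, `|y - x| <= r -> `|dird (b i) (fN N) y - G i| <= e1.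
  have /choice[r Hr] : forall i, exists r : R, 0 < r /\ \forall N \near \oo,
      forall y, `|y - x| <= r -> `|dird (b i) (fN N) y - G i| <= e1.
    by move=> i; have [r r0 Hr] := dG i _ e10; exists r.
  exists (\big[Num.min/1]_i r i).
    by apply: lt_bigmin => // i _; case: (Hr i).
  move=> i; have [_ ] := Hr i; apply: filterS => N HN y yx; apply: HN.
  by apply: le_trans yx _; apply: bigmin_le_cond.
exists r => // h hr.
(* Convergence of [fN] is only pointwise, so N is chosen after [h]; the slack [eta] absorbs the
   errors at x and at x + h. *)
apply/ler_addgt0Pr => eta eta0.
have eta20 : 0 < eta / 2 by rewrite divr_gt0.
near \oo => N.
have [t t01 E] := mvt_line x h (dN N).
have A1 : `|fN N (x + h) - f (x + h)| <= eta / 2.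
  near: N; have /cvgrPdist_le/(_ _ eta20) := fNf (x + h).
  by apply: filterS => N; rewrite distrC.
have A2 : `|fN N x - f x| <= eta / 2.
  near: N; have /cvgrPdist_le/(_ _ eta20) := fNf x.
  by apply: filterS => N; rewrite distrC.
have A3 : forall i y, `|y - x| <= r -> `|dird (b i) (fN N) y - G i| <= e1.
  by near: N; apply: filter_forall.
have B : `|dird h (fN N) (x + t *: h) - comb G h| <= e * `|h|.
  rewrite dird_frame /comb -sumrB.
  have -> : \sum_i (c i h * dird (b i) (fN N) (x + t *: h) - c i h * G i) =
    comb (fun i => dird (b i) (fN N) (x + t *: h) - G i) h.
    by apply: eq_bigr => i _; rewrite mulrBr.
  apply: le_trans (comb_le (K := e1) _ _) _.
    move=> i; apply: A3; rewrite addrC addKr normrZ ger0_norm;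
      last by case/andP: t01.
    by apply: le_trans hr; rewrite ler_piMl //; case/andP: t01.
  apply: ler_wpM2r => //.
  by rewrite /e1 mulrCA ger_pMr // ler_pdivrMr // mul1r lerDl.
rewrite (_ : _ - _ = dird h (fN N) (x + t *: h) - comb G h
   - (fN N (x + h) - f (x + h)) + (fN N x - f x)); last by rewrite -E; ring.
apply: le_trans (ler_normD _ _) _.
apply: le_trans (lerD (ler_normB _ _) (lexx _)) _.
rewrite [eta]splitr -addrA; apply: lerD => //.
exact: lerD.
Unshelve. all: by end_near. Qed.

(** The quotient equals a derivative of [g] along [w] at a point within |w| / (N + 1) of y, which
    makes the convergence uniform for y near x. *)
Lemma difference_quotient_near (g : V -> R) (w : V) x (e : R) :
  diffable g -> {for x, continuous (dird w g)} -> 0 < e ->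
  exists2 r : R, 0 < r & \forall N \near \oo, forall y, `|y - x| <= r ->
    `|(N.+1%:R^-1)^-1 * (g (y + N.+1%:R^-1 *: w) - g y) - dird w g x| <= e.
Proof.
move=> dg cg e0.
have /cvgrPdist_le/(_ _ e0)/nbhs_ballP[r /= r0 Hr] := cg.
exists (r / 2); first by rewrite divr_gt0.
have r20 : 0 < r / (2 * (`|w| + 1)) by rewrite divr_gt0 // mulr_gt0 // ltr_wpDl.
near=> N => y yx.
have sN : N.+1%:R^-1 < r / (2 * (`|w| + 1)).
  near: N; have /cvgrPdist_lt/(_ _ r20) := @cvg_harmonic R.
  by apply: filterS => N; rewrite sub0r normrN ger0_norm // invr_ge0.
have [t t01 E] := mvt_line y (N.+1%:R^-1 *: w) dg.
rewrite E dirdZl mulKf ?invr_eq0 ?pnatr_eq0 // distrC.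
apply: Hr; rewrite -ball_normE /= distrC addrAC.
apply: le_lt_trans (ler_normD _ _) _; rewrite [r]splitr.
apply: ler_ltD => //.
rewrite !normrZ ger0_norm; last by case/andP: t01.
apply: (@le_lt_trans _ _ (`|N.+1%:R^-1 : R| * `|w|)).
  by rewrite ler_piMl ?mulr_ge0 //; case/andP: t01.
rewrite ger0_norm ?invr_ge0 //.
apply: (@le_lt_trans _ _ (N.+1%:R^-1 * (`|w| + 1))).
  by rewrite ler_wpM2l ?invr_ge0 // lerDl.
rewrite -ltr_pdivlMr; last by rewrite ltr_wpDl.
by apply: lt_le_trans sN _; rewrite -mulrA -invfM.
Unshelve. all: by end_near. Qed.

(* The difference quotients of f in the direction w converge to D_w f together
   with their derivatives. *)
Lemma dirdC (f : V -> R) v w : Cn 2 f -> dird v (dird w f) = dird w (dird v f).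
Proof.
move=> cf; apply/funext => x.
have df := Cn_diffable cf.
have dwf := Cn_dird w cf.
have cDw i : continuous (dird w (dird (b i) f)).
  by have := Cn_dird w (Cn_dird (b i) cf); apply.
pose s (N : nat) : R := N.+1%:R^-1.
have s0 N : 0 < s N by rewrite invr_gt0 ltr0n.
have sl N : s N != 0 by rewrite gt_eqF.
have As N y u : (y + u) + s N *: w = (y + s N *: w) + u by rewrite addrAC.
have cid : continuous (idfun : V -> V) by move=> y; apply: cvg_id.
pose fN N y := (s N)^-1 * (f (y + s N *: w) - f y).
have sf N : Cn 2 (fun y => f (y + s N *: w)).
  exact: (Cn_affine (L := idfun) cid (As N) cf).
have cfN N : Cn 2 (fN N) := CnZ (s N)^-1 (CnB (sf N) cf).
have DfN N u y : dird u (fN N) y =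
    (s N)^-1 * (dird u f (y + s N *: w) - dird u f y).
  rewrite /fN dirdZ; last exact: (Cn_diffable (CnB (sf N) cf)).
  congr (_ * _).
  have -> : (fun y => f (y + s N *: w) - f y) =
      fun y => f (y + s N *: w) + (-1) * f y.
    by apply/funext => z; rewrite mulN1r.
  rewrite dirdD; first last.
  - exact: (Cn_diffable (CnZ (-1) cf)).
  - exact: (Cn_diffable (sf N)).
  by rewrite (dird_affine (L := idfun) cid (As N)) // dirdZ // mulN1r.
have [i e e0|y|_ E] := @limit_differentiable fN (dird w f)
    (fun i => dird w (dird (b i) f) x) x (fun N => Cn_diffable (cfN N)).
- have [r r0 Hr] := difference_quotient_near (Cn_diffable (Cn_dird (b i) cf))
  (@cDw i x) e0.
  by exists r => //; apply: filterS Hr => N HN y yx; rewrite DfN; apply: HN.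
- apply/cvgrPdist_le => e e0.
  have cw : continuous (dird w f) by apply: Cn_continuous dwf.
  have [r r0] := difference_quotient_near df (@cw y) e0.
  by apply: filterS => N HN; rewrite distrC; apply: HN;
    rewrite subrr normr0 ltW.
- have dbf i : diffable (dird (b i) f) by apply: Cn_diffable (Cn_dird (b i) cf).
  have -> : dird v f = fun y => \sum_i c i v * dird (b i) f y.
    by apply/funext => y; rewrite dird_frame.
  rewrite [LHS]E dird_sum; last by move=> i _; apply: diffableM => // y;
    exact: differentiable_cst.
  by apply: eq_bigr => i _; rewrite dirdZ.
Qed.

(* The head of the list is the innermost derivative. *)
Fixpoint dirds (vs : seq V) (f : V -> R) : V -> R :=
  if vs is v :: ws then dirds ws (dird v f) else f.

Definition ucauchy (g : nat -> V -> R) := forall (M e : R), 0 < e ->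
  exists N0, forall N N', (N0 <= N)%N -> (N0 <= N')%N ->
  forall x, `|x| <= M -> `|g N x - g N' x| <= e.

Lemma ucauchy_limit g : ucauchy g -> exists2 G : V -> R,
  (forall x, g ^~ x @ \oo --> G x) &
  forall (M e : R), 0 < e -> exists N0, forall N, (N0 <= N)%N ->
    forall x, `|x| <= M -> `|g N x - G x| <= e.
Proof.
move=> Hg.
have Hc x : g ^~ x @ \oo --> limn (g ^~ x).
  apply/cauchy_cvgP/cauchy_exP => e /= e0.
  have e20 : 0 < e / 2 by rewrite divr_gt0.
  have [N0 HN] := Hg `|x| _ e20.
  exists (g N0 x); exists N0 => // N /= N0N.
  rewrite -ball_normE /=.
  by apply: le_lt_trans (HN _ _ _ N0N _ (lexx _)) _ => //; lra.
exists (fun x => limn (g ^~ x)) => // M e e0.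
have [N0 HN] := Hg M _ e0.
exists N0 => N N0N x xM; apply/ler_addgt0Pr => eta eta0.
near \oo => N'.
apply: le_trans (ler_distD (g N' x) _ _) _; apply: lerD.
  by apply: HN => //; near: N'; exists N0.
by near: N'; have /cvgrPdist_le/(_ _ eta0) := Hc x; apply: filterS => k;
  rewrite distrC.
Unshelve. all: by end_near. Qed.

Lemma limit_continuous g (G : V -> R) : (forall N, continuous (g N)) ->
  (forall (M e : R), 0 < e -> exists N0, forall N, (N0 <= N)%N ->
    forall x, `|x| <= M -> `|g N x - G x| <= e) -> continuous G.
Proof.
move=> cg gG x; apply/cvgrPdist_le => e e0.
have e30 : 0 < e / 3 by rewrite divr_gt0.
have [N0 HN] := gG (`|x| + 1) _ e30.
have /cvgrPdist_le/(_ _ e30) := cg N0 x.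
have xb : \forall y \near x, `|x - y| < 1.
  by apply/nbhs_ballP; exists 1 => //= y; rewrite -ball_normE.
move=> Hn; near=> y.
have yx1 : `|y| <= `|x| + 1.
  have xy : `|x - y| < 1 by near: y.
  by rewrite -lerBlDl; apply: le_trans (ltW xy); rewrite distrC lerB_dist.
have A1 := HN _ (leqnn _) _ yx1.
have A2 : `|g N0 x - G x| <= e / 3 by apply: HN; rewrite // lerDl.
have A3 : `|g N0 x - g N0 y| <= e / 3 by near: y.
rewrite (_ : _ - _ = (g N0 x - g N0 y) + (g N0 y - G y) - (g N0 x - G x));
  last by ring.
apply: le_trans (ler_normB _ _) _;
  apply: le_trans (lerD (ler_normD _ _) (lexx _)) _.
by lra.
Unshelve. all: by end_near. Qed.

(** The Cauchy hypothesis for lists beginning with v is the induction hypothesis for the derivatives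
    along v. Their limits [G v] are thus C^n, and the continuity of [G (b i)] supplies the local
    bound required by [limit_differentiable]. *)
Lemma limit_Cn n (g : nat -> V -> R) (f : V -> R) :
  (forall N, Cn n (g N)) ->
  (forall vs : seq V, (size vs <= n)%N -> ucauchy (fun N => dirds vs (g N))) ->
  (forall x, g ^~ x @ \oo --> f x) ->
  Cn n f.
Proof.
elim: n g f => [|n IH] g f cg ug gf.
  have [G Gx Gu] := ucauchy_limit (ug [::] isT).
  have -> : f = G by apply/funext => x; apply: (cvg_unique _ (gf x) (Gx x)).
  exact: limit_continuous cg Gu.
have /choice[G HG] : forall v, exists G : V -> R,
    (forall x, (fun N => dird v (g N) x) @ \oo --> G x) /\
    (forall (M e : R), 0 < e -> exists N0, forall N, (N0 <= N)%N ->
      forall x, `|x| <= M -> `|dird v (g N) x - G x| <= e).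
  by move=> v; have [|G G1 G2] := ucauchy_limit (ug [:: v] _); [|exists G].
have cG v : Cn n (G v).
  apply: (IH (fun N => dird v (g N))); last by case: (HG v).
    by move=> N; apply: Cn_dird.
  by move=> vs sz; apply: (ug (v :: vs)).
have D x : differentiable f x /\ forall v,
  'd f x v = comb (fun i => G (b i) x) v.
  apply: (@limit_differentiable g) => // [N|i e e0];
    first exact: Cn_diffable (cg N).
  have e20 : 0 < e / 2 by rewrite divr_gt0.
  have cGi : continuous (G (b i)) := Cn_continuous (cG (b i)).
  have /cvgrPdist_le/(_ _ e20)/nbhs_ballP[r /= r0 Hr] := cGi x.
  exists (r / 2); first by rewrite divr_gt0.
  have [N0 HN] := (HG (b i)).2 (`|x| + r) _ e20.
  exists N0 => // N /= N0N y yx.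
  have yr : `|y| <= `|x| + r.
    by rewrite -lerBlDl; apply: le_trans (lerB_dist _ _) _;
      apply: le_trans yx _; lra.
  have A1 := HN _ N0N _ yr.
  have A2 : `|G (b i) x - G (b i) y| <= e / 2.
    by apply: Hr; rewrite -ball_normE /= distrC; apply: le_lt_trans yx _; lra.
  rewrite (_ : _ - _ = (dird (b i) (g N) y - G (b i) y) - (G (b i) x - G (b i)
    y)); last by ring.
  by apply: le_trans (ler_normB _ _) _; lra.
split=> [x|v]; first by case: (D x).
(* The differential comes out as a combination over the frame; uniqueness of limits identifies it
   with [G v]. *)
have -> : (fun x => 'd f x v) = G v; last exact: cG.
apply/funext => x; rewrite (D x).2.
have Hs : (fun N => \sum_i c i v * dird (b i) (g N) x) @ \oo -->
    comb (fun i => G (b i) x) v.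
  apply: cvg_big => [|i _]; first exact: (@add_continuous R).
  by apply: cvgM; [exact: cvg_cst|exact: (HG (b i)).1].
have -> : comb (fun i => G (b i) x) v = limn (fun N => dird v (g N) x).
  apply/esym/(cvg_lim (@Rhausdorff R)).
  rewrite (_ : (fun N => dird v (g N) x) = fun N =>
    \sum_i c i v * dird (b i) (g N) x) //.
  by apply/funext => N; rewrite dird_frame.
by apply: (cvg_lim (@Rhausdorff R)); exact: (HG v).1.
Qed.

End FrameLimit.

(** * Plane rotations *)

Section PlaneRotations.
Context (R : realType) (d : nat).
Local Notation S := (symmx R d).
Local Notation M := 'M[R]_d.

Fact symmetrize_sym (y : M) : sym_pred (2^-1 *: (y + y^T)).
Proof. by rewrite sym_predE linearZ /= linearD /= trmxK addrC. Qed.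

(** The linear projection onto symmetric matrices. Elements of [symmx] are built through it, so that
    linearity is available without handling symmetry proofs. *)
Definition symmetrize (y : M) : S := SymMx (symmetrize_sym y).

Fact symmetrize_linear : linear symmetrize.
Proof.
move=> a u v; apply: val_inj; apply/matrixP => i j; rewrite !mxE; ring.
Qed.

HB.instance Definition _ :=
  GRing.isLinear.Build R M S _ symmetrize symmetrize_linear.

Lemma symval_tr (x : S) : (symval x)^T = symval x.
Proof. by case: x => x /= px; apply/eqP; rewrite -sym_predE. Qed.

Lemma symvalC (x : S) i j : symval x i j = symval x j i.
Proof. by rewrite -{1}symval_tr mxE. Qed.

Lemma symmetrizeK (x : S) : symmetrize (symval x) = x.
Proof.
by apply: val_inj; apply/matrixP => i j; rewrite /= symval_tr !mxE; field.
Qed.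

Lemma symval_symmetrize (y : M) : y^T = y -> symval (symmetrize y) = y.
Proof.
by move=> e; apply/matrixP => i j; rewrite /= e !mxE; field.
Qed.

Lemma mx_entry_le m n (y : 'M[R]_(m, n)) i j : `|y i j| <= `|y|.
Proof.
rewrite [leRHS]/Num.norm /= mx_normrE.
by apply: (le_bigmax _ (fun ij : 'I_m * 'I_n => `|y ij.1 ij.2|) (i, j)).
Qed.

Lemma mx_norm_leP m n (y : 'M[R]_(m, n)) (K : R) : 0 <= K ->
  (forall i j, `|y i j| <= K) -> `|y| <= K.
Proof.
move=> K0 H; rewrite [leLHS]/Num.norm /= mx_normrE;
  by apply: bigmax_le => // -[i j] _.
Qed.

Lemma symnormE (x : S) : `|x| = `|symval x|.
Proof. by []. Qed.

Lemma symval_continuous : continuous (@symval R d).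
Proof.
by apply: (@linear_le_continuous _ _ _ (val : {linear S -> M}) 1) => x;
  rewrite mul1r.
Qed.

Section Rotation.
Variables (i j : 'I_d).
Hypothesis ij : i != j.

Definition rotgen : M := delta_mx i j - delta_mx j i.
Definition rotproj : M := delta_mx i i + delta_mx j j.
Local Notation A := rotgen.
Local Notation P := rotproj.

Lemma rotgen_tr : A^T = - A.
Proof. by rewrite /A linearB /= !trmx_delta opprB. Qed.

Lemma rotproj_tr : P^T = P.
Proof. by rewrite /P linearD /= !trmx_delta. Qed.

Lemma rotgen_sq : A *m A = - P.
Proof.
rewrite /A /P mulmxBl !mulmxBr !mul_delta_mx_cond !eqxx [j == i]eq_sym (negbTE
  ij).
by rewrite !mulr0n !mulr1n sub0r subr0 opprD addrC.
Qed.

Lemma rotproj_sq : P *m P = P.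
Proof.
rewrite /P mulmxDl !mulmxDr !mul_delta_mx_cond !eqxx [j == i]eq_sym (negbTE ij).
by rewrite !mulr0n !mulr1n add0r addr0.
Qed.

Lemma rotgen_proj : A *m P = A.
Proof.
rewrite /A /P mulmxBl !mulmxDr !mul_delta_mx_cond !eqxx [j == i]eq_sym (negbTE
  ij).
by rewrite !mulr0n !mulr1n add0r addr0.
Qed.

Lemma rotproj_gen : P *m A = A.
Proof.
rewrite /A /P mulmxDl !mulmxBr !mul_delta_mx_cond !eqxx [j == i]eq_sym (negbTE
  ij).
by rewrite !mulr0n !mulr1n sub0r subr0.
Qed.

(** This is exp (t A): since A^2 = - P and A P = A, the exponential series collapses to a sine term
    and a cosine term. *)
Definition planerot (t : R) : M := 1%:M + sin t *: A + (cos t - 1) *: P.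

Lemma planerot_tr t : (planerot t)^T = planerot (- t).
Proof.
rewrite /planerot linearD /= linearD /= !linearZ /= trmx1 rotgen_tr rotproj_tr.
by rewrite sinN cosN scalerN scaleNr.
Qed.

Lemma planerotM s t : planerot s *m planerot t = planerot (s + t).
Proof.
rewrite /planerot mulmxDl !mulmxDr !mulmxDl !mul1mx !mulmx1.
rewrite -!scalemxAl -!scalemxAr rotgen_sq rotproj_sq rotgen_proj rotproj_gen.
rewrite sinD cosD; apply/matrixP => k l; rewrite !mxE; ring.
Qed.

Lemma planerot0 : planerot 0 = 1%:M.
Proof. by rewrite /planerot sin0 cos0 subrr !scale0r !addr0. Qed.

Lemma planerot_rotation t : is_rotation (planerot t).
Proof.
rewrite /is_rotation planerot_tr planerotM subrr planerot0 eqxx /=.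
(* The rotation by t is the square of the rotation r by t / 2, so its determinant is det r * det r^T
   = det (r r^T) = 1. *)
have -> : t = t / 2 + t / 2 by rewrite -splitr.
rewrite -planerotM det_mulmx -{2}det_tr planerot_tr -det_mulmx planerotM subrr
  planerot0.
by rewrite det1.
Qed.

End Rotation.

Lemma rotation_inv (g : M) : is_rotation g -> invmx g = g^T.
Proof.
case/andP=> /eqP gg _.
have ug : g \in unitmx by have [] := mulmx1_unit gg.
by rewrite -[RHS](mulKmx ug) gg mulmx1.
Qed.

Lemma rotation_mulVmx (g : M) : is_rotation g -> g^T *m g = 1%:M.
Proof. by case/andP=> /eqP gg _; apply: mulmx1C. Qed.

Lemma sym_conjE (g : M) (hg : is_rotation g) (x : S) :
  symval (sym_conj hg x) = g *m symval x *m g^T.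
Proof. by rewrite -rotation_inv. Qed.

Fact sym_conj_linear (g : M) (hg : is_rotation g) : linear (sym_conj hg).
Proof.
move=> a u v; apply: val_inj => /=.
by rewrite mulmxDr mulmxDl -scalemxAr -scalemxAl.
Qed.

HB.instance Definition _ (g : M) (hg : is_rotation g) :=
  GRing.isLinear.Build R S S _ (sym_conj hg) (sym_conj_linear hg).

(** The infinitesimal conjugation by exp (t a). For skew [a] the commutator is already symmetric,
    and [symmetrize] does not change it. *)
Definition bracket (a : M) (x : S) : S :=
  symmetrize (a *m symval x - symval x *m a).

Fact bracket_linear (a : M) : linear (bracket a).
Proof.
move=> k u v; rewrite /bracket -linearP /=; congr symmetrize.
rewrite mulmxDr mulmxDl -scalemxAr -scalemxAl scalerBr; apply/matrixP => p q.
by rewrite !mxE; ring.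
Qed.

HB.instance Definition _ (a : M) :=
  GRing.isLinear.Build R S S _ (bracket a) (bracket_linear a).

(** For s = sin t and c = cos t - 1 this is conjugation by a plane rotation. All dependence on t
    sits in the scalar coefficients, so the curve can be differentiated term by term. *)
Lemma conj_expand (A P y : M) (s c : R) :
  (1%:M + s *: A + c *: P) *m y *m (1%:M + (- s) *: A + c *: P) =
  y + s *: (A *m y - y *m A) + c *: (P *m y + y *m P)
  + (s * s) *: (- (A *m y *m A)) + (s * c) *: (A *m y *m P - P *m y *m A)
  + (c * c) *: (P *m y *m P).
Proof.
rewrite !mulmxDl !mulmxDr !mul1mx !mulmx1 -!scalemxAl -!scalemxAr.
move: (A *m y *m A) (A *m y *m P) (P *m y *m A) (P *m y *m P).
by move=> X1 X2 X3 X4; apply/matrixP => p q; rewrite !mxE; ring.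
Qed.

Lemma is_derive_conj_rot (G : S -> R) (i j : 'I_d) (x : S) : i != j ->
  diffable G ->
  is_derive (0 : R) (1 : R)
    (fun t : R => G (symmetrize (planerot i j t *m symval x *m (planerot i j
      t)^T)))
    (dird (bracket (rotgen i j) x) G x).
Proof.
move=> ij dG.
pose u t := symmetrize (planerot i j t *m symval x *m (planerot i j t)^T).
set A := rotgen i j; set P := rotproj i j.
pose y := symval x.
have u0 : u 0 = x by rewrite /u planerot0 trmx1 mul1mx mulmx1 symmetrizeK.
(* Among the coefficients sin t, cos t - 1 and their products, only sin t has a nonzero derivative
   at 0; hence the velocity of [u] at 0 is [T1]. *)
pose T1 : S := bracket A x.
pose T2 := symmetrize (P *m y + y *m P).
pose T3 := symmetrize (- (A *m y *m A)).
pose T4 := symmetrize (A *m y *m P - P *m y *m A).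
pose T5 := symmetrize (P *m y *m P).
have uE : u = fun t => x + sin t *: T1 + (cos t - 1) *: T2 + (sin t * sin t) *:
  T3
    + (sin t * (cos t - 1)) *: T4 + ((cos t - 1) * (cos t - 1)) *: T5.
  have sD a b : symmetrize (a + b) = symmetrize a + symmetrize b by exact:
    linearD.
  have sZ a b : symmetrize (a *: b) = a *: symmetrize b by exact: linearZ.
  apply/funext => t; rewrite /u planerot_tr /planerot sinN cosN -/A -/P -/y
    conj_expand.
  by rewrite !sD !sZ symmetrizeK.
have Z (k : R -> R) (k' : R) (T : S) : is_derive (0 : R) (1 : R) k k' ->
    is_derive (0 : R) (1 : R) (fun t => k t *: T) (k' *: T).
  move=> [dk kE]; have dk' : differentiable k 0 by apply/derivable1_diffP.
  have dZ : differentiable (fun t => k t *: T) 0 by apply: differentiableZl.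
  split; first exact/derivable1_diffP.
  by rewrite deriveE // diffZl // -kE deriveE.
have M (k l : R -> R) (k' l' : R) : is_derive (0 : R) (1 : R) k k' ->
    is_derive (0 : R) (1 : R) l l' ->
    is_derive (0 : R) (1 : R) (fun t => k t * l t) (k 0 * l' + l 0 * k').
  by move=> hk hl; apply: is_derive_eq.
have ds : is_derive (0 : R) (1 : R) (fun t : R => sin t : R) 1.
  by apply: is_derive_eq; rewrite cos0.
have dc : is_derive (0 : R) (1 : R) (fun t : R => cos t - 1 : R) 0.
  by apply: is_derive_eq; rewrite sin0 !oppr0 addr0.
have du : is_derive (0 : R) (1 : R) u T1.
  rewrite uE; have := (is_deriveD (is_deriveD (is_deriveD (is_deriveD
    (is_deriveD
    (is_derive_cst x (0 : R) (1 :
      R)) (Z _ _ T1 ds)) (Z _ _ T2 dc)) (Z _ _ T3 (M _ _ _ _ ds ds)))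
    (Z _ _ T4 (M _ _ _ _ ds dc))) (Z _ _ T5 (M _ _ _ _ dc dc))).
  move=> D; apply: is_derive_eq.
  by rewrite !sin0 cos0 subrr !mul0r !addr0 !scale0r !addr0 scale1r add0r.
have du' : differentiable u 0 by apply/derivable1_diffP; case: du.
have dGu : differentiable (G \o u) 0.
  by apply: differentiable_comp; rewrite ?u0.
split; first exact/derivable1_diffP.
rewrite deriveE // (diff_comp du') //= u0 /dird; congr ('d G x _).
by case: du => _ E; rewrite -deriveE //; exact: E.
Qed.

End PlaneRotations.

(** * Spectral theorem *)

Lemma Cn_prod (R : realType) (V : normedModType R) n (I : Type) (s : seq I)
    (P : pred I) (f : I -> V -> R) :
  (forall i, P i -> Cn n (f i)) -> Cn n (fun x => \prod_(i <- s | P i) f i x).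
Proof.
move=> H; elim: s => [|i s IH].
  have -> : (fun x => \prod_(i <- [::] | P i) f i x) = fun=> 1.
    by apply/funext => x; rewrite big_nil.
  exact: Cn_cst.
have -> : (fun x => \prod_(j <- i :: s | P j) f j x) =
    fun x => if P i then f i x * \prod_(j <- s | P j) f j x
             else \prod_(j <- s | P j) f j x.
  by apply/funext => x; rewrite big_cons.
by case Pi: (P i) => //; apply: CnM => //; apply: H.
Qed.

Section Spectral.
Context (R : realType) (d : nat).
Local Notation S := (symmx R d).
Local Notation M := 'M[R]_d.

Lemma rotgenE (i j k l : 'I_d) (y : M) :
  ((rotgen R i j *m y) k l = (k == i)%:R * y j l - (k == j)%:R * y i l) /\
  ((y *m rotgen R i j) k l = y k i * (l == j)%:R - y k j * (l == i)%:R).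
Proof.
split; rewrite !mxE.
  under eq_bigr do rewrite !mxE mulrBl.
  rewrite sumrB (bigD1 j) //= big1 ?addr0 => [|p /negbTE pj]; last first.
    by rewrite pj andbF mul0r.
  rewrite (bigD1 i) //= big1 ?addr0 => [|p /negbTE pi]; last first.
    by rewrite pi andbF mul0r.
  by rewrite !eqxx !andbT.
under eq_bigr do rewrite !mxE mulrBr.
rewrite sumrB (bigD1 i) //= big1 ?addr0 => [|p /negbTE pi]; last first.
  by rewrite pi mulr0.
rewrite (bigD1 j) //= big1 ?addr0 => [|p /negbTE pj]; last first.
  by rewrite pj mulr0.
by rewrite !eqxx.
Qed.

Lemma bracketE (i j k l : 'I_d) (x : S) :
  symval (bracket (rotgen R i j) x) k l =
  (k == i)%:R * symval x j l - (k == j)%:R * symval x i l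
  - (symval x k i * (l == j)%:R - symval x k j * (l == i)%:R).
Proof.
rewrite [bracket _ _]/(symmetrize _) symval_symmetrize.
  by rewrite mxE [X in _ + X]mxE (rotgenE i j k l (symval x)).1 (rotgenE i j k l
    (symval x)).2.
rewrite linearB /= !trmx_mul rotgen_tr symval_tr mulmxN mulNmx opprK addrC //.
Qed.

Lemma trmx_conj (g : M) (x : S) :
  (g *m symval x *m g^T)^T = g *m symval x *m g^T.
Proof. by rewrite !trmx_mul trmxK symval_tr mulmxA. Qed.

Lemma planerot_conjD (i j : 'I_d) (s t : R) (x : S) : i != j ->
  symmetrize (planerot i j s *m
    symval (symmetrize (planerot i j t *m symval x *m (planerot i j t)^T)) *m
    (planerot i j s)^T) =
  symmetrize (planerot i j (s + t) *m symval x *m (planerot i j (s + t))^T).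
Proof.
move=> ij; rewrite (symval_symmetrize (trmx_conj _ _)) -planerotM //.
by rewrite trmx_mul !mulmxA.
Qed.

Lemma rotationM (g h : M) : is_rotation g -> is_rotation h ->
  is_rotation (g *m h).
Proof.
move=> /andP[/eqP g1 /eqP g2] /andP[/eqP h1 /eqP h2]; apply/andP; split.
  by rewrite trmx_mul mulmxA -(mulmxA g) h1 mulmx1 g1.
by rewrite det_mulmx g2 h2 mulr1.
Qed.

Lemma rotation1 : is_rotation (1%:M : M).
Proof. by rewrite /is_rotation trmx1 mulmx1 det1 !eqxx. Qed.

Lemma rotation_entry_le (g : M) i j : is_rotation g -> `|g i j| <= 1.
Proof.
move=> /andP[/eqP/matrixP/(_ i i) + _]; rewrite !mxE eqxx => E.
have : g i j ^+ 2 <= 1.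
  rewrite -[leRHS]E (bigD1 j) //= mxE -expr2 lerDl; apply: sumr_ge0 => k _.
  by rewrite mxE -expr2 sqr_ge0.
by rewrite -real_normK ?num_real // expr_le1.
Qed.

Let coordv (i j : 'I_d) (v : 'rV[R]_(d * d)) : R := vec_mx v i j.

Let coordv_continuous i j : continuous (coordv i j).
Proof.
rewrite (_ : coordv i j = fun v => v ord0 (mxvec_index i j)).
  exact: coord_continuous.
by apply/funext => v; rewrite /coordv mxE.
Qed.

(** The entries of a rotation are bounded by 1, and rotations are cut out by the polynomial
    equations g g^T = 1 and det g = 1. *)
Lemma rotation_compact :
  compact [set v : 'rV[R]_(d * d) | is_rotation (vec_mx v)].
Proof.
apply: bounded_closed_compact.
  exists 1; split; first exact: num_real.
  move=> x x1 v /= rv; apply: le_trans (ltW x1).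
  rewrite -[v]vec_mxK; apply: mx_norm_leP => // i j.
  by case/mxvec_indexP: j => p q; rewrite ord1 mxvecE; apply: rotation_entry_le.
pose f ij (v : 'rV[R]_(d * d)) : R := \sum_k coordv ij.1 k v * coordv ij.2 k v.
pose h (v : 'rV[R]_(d * d)) : R :=
  \sum_(s : 'S_d) (-1) ^+ s * \prod_i coordv i (s i) v.
have cf ij : continuous (f ij).
  by apply: (@Cn_sum _ _ 0) => k _; apply: (@CnM _ _ 0);
    exact: coordv_continuous.
have ch : continuous h.
  apply: (@Cn_sum _ _ 0) => s _; apply: (@CnZ _ _ 0);
    apply: (@Cn_prod _ _ 0) => i _.
  exact: coordv_continuous.
have -> : [set v : 'rV[R]_(d * d) | is_rotation (vec_mx v)] =
   (\bigcap_(ij in [set: 'I_d * 'I_d]) (f ij @^-1` [set (ij.1 == ij.2)%:R]))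
    `&` (h @^-1` [set 1]).
  apply/seteqP; split => v /=.
    move=> /andP[/eqP/matrixP E /eqP D]; split; last exact: D.
    move=> [i j] _ /=; have := E i j; rewrite !mxE => <-.
    by rewrite /f; apply: eq_bigr => k _; rewrite /coordv !mxE.
  move=> [E D]; apply/andP; split; apply/eqP; last exact: D.
  apply/matrixP => i j; rewrite !mxE -(E (i, j) I) /f.
  by apply: eq_bigr => k _; rewrite /coordv !mxE.
apply: closedI.
  apply: closed_bigI => ij _; apply: closed_comp => [v _|]; first exact: cf.
  exact: closed_eq.
apply: closed_comp => [v _|]; first exact: ch.
exact: closed_eq.
Qed.

Let weight (y : M) : R := \sum_(k < d) k%:R * y k k.

Definition symweight (x : S) : R := weight (symval x).

Fact symweight_linear : linear symweight.
Proof.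
move=> a u v; rewrite /symweight /weight scaler_sumr -big_split /=.
by apply: eq_bigr => k _; rewrite !mxE /GRing.scale /=; ring.
Qed.

HB.instance Definition _ :=
  GRing.isLinear.Build R S R _ symweight symweight_linear.

Lemma sum_delta (i : 'I_d) (F : 'I_d -> R) : \sum_k (k == i)%:R * F k = F i.
Proof.
rewrite (bigD1 i) //= eqxx mul1r big1 ?addr0 // => k /negbTE ->.
by rewrite mul0r.
Qed.

(** The first variation of the weight under rotations of the plane (i, j). As the weights are
    distinct, i - j is nonzero for distinct indices, so a critical point has entry (i, j) equal to
    0. *)
Lemma symweight_bracket (i j : 'I_d) (y : S) :
  symweight (bracket (rotgen R i j) y) = 2 * (i%:R - j%:R) * symval y i j.
Proof.
rewrite /symweight /weight.
transitivity (\sum_(k < d) ((k == i)%:R * (k%:R * (symval y j k + symval y k j))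
  -
    (k == j)%:R * (k%:R * (symval y i k + symval y k i)))).
  by apply: eq_bigr => k _; rewrite bracketE; ring.
by rewrite sumrB !sum_delta (symvalC y j i); ring.
Qed.

(* A rotation g maximizing tr (W g x g^T) for W = diag (0, 1, ..., d - 1)
   diagonalizes x: by the first-order condition g x g^T commutes with W, whose
   eigenvalues are distinct. *)
Theorem spectral (x : S) : exists (g : M) (hg : is_rotation g),
  is_diag_mx (symval (sym_conj hg x)).
Proof.
have cw : continuous symweight.
  apply: (@Cn_sum _ _ 0) => k _; apply: (@CnM _ _ 0);
    first exact: cst_continuous.
  move=> y; apply: (@continuous_comp _ _ _ (@symval R d) (fun z : M => z k k)).
    exact: symval_continuous.
  exact: coord_continuous.
pose f (v : 'rV[R]_(d * d)) : R :=
  \sum_(k < d) k%:R * \sum_q \sum_p coordv k p v * symval x p q * coordv k q v.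
have fE v : f v = weight (vec_mx v *m symval x *m (vec_mx v)^T).
  apply: eq_bigr => k _; congr (_ * _); rewrite mxE; apply: eq_bigr => q _.
  by rewrite mxE mulr_suml; apply: eq_bigr => p _; rewrite [X in _ = _ * X]mxE.
have cf : continuous f.
  apply: (@Cn_sum _ _ 0) => k _; apply: (@CnZ _ _ 0).
  do 2![apply: (@Cn_sum _ _ 0) => ? _].
  apply: (@CnM _ _ 0); last exact: coordv_continuous.
  by apply: (@CnM _ _ 0); [exact: coordv_continuous|exact: cst_continuous].
have [|v /set_mem /= rv vmax] :=
  compact_EVT_max _ rotation_compact (continuous_subspaceT cf).
  by exists (mxvec 1%:M); rewrite /= mxvecK; exact: rotation1.
exists (vec_mx v), rv; apply/is_diag_mxP => i j ij0.
have {ij0}ij : i != j by [].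
set B := sym_conj rv x.
have dG : diffable symweight.
  by move=> y; apply: (@linear_differentiable _ _ _ (symweight : {linear S ->
    R})).
pose phi t := symweight (symmetrize (planerot i j t *m symval B *m (planerot i j
  t)^T)).
have phiE t : phi t = f (mxvec (planerot i j t *m vec_mx v)).
  rewrite fE mxvecK /phi /symweight symval_symmetrize.
    by rewrite /B sym_conjE trmx_mul !mulmxA.
  exact: trmx_conj.
(* By the group law, derivability at t is derivability at 0 for the matrix already rotated by t. *)
have dphi t : derivable phi t 1.
  pose Bt := symmetrize (planerot i j t *m symval B *m (planerot i j t)^T).
  have D0 := is_derive_conj_rot Bt ij dG.
  have -> : phi = (fun s => symweight (symmetrize (planerot i j s *m symval Bt
    *m (planerot i j s)^T)))
     \o (fun u => u - t).
    apply/funext => u.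
    have E := congr1 symweight (planerot_conjD (u - t) t B ij).
    by rewrite subrK in E; exact: (esym E).
  apply/derivable1_diffP/differentiable_comp; first exact/derivable1_diffP.
  by rewrite subrr; apply/derivable1_diffP; case: D0.
have phi_max : is_derive (0 : R) (1 : R) phi 0.
  apply: (@derive1_at_max _ phi (-1) 1 0) => //.
  - by rewrite in_itv /= ltrN10 ltr01.
  move=> t _; rewrite !phiE;
    apply: le_trans (vmax (mxvec (planerot i j t *m vec_mx v)) _) _.
    rewrite inE /= mxvecK; exact: rotationM (planerot_rotation ij t) rv.
  by rewrite planerot0 mul1mx vec_mxK.
have := is_derive_conj_rot B ij dG => -[_].
case: phi_max => _ ->.
have swc : continuous (symweight : {linear S -> R}) by [].
rewrite (dird_lin _ swc) [X in _ = X]symweight_bracket => /esym/eqP.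
rewrite !mulf_eq0 pnatr_eq0 /= subr_eq0 eqr_nat [_ == _ :> nat](negbTE ij) /=.
by move/eqP.
Qed.

End Spectral.

(** * Iterated directional derivatives *)

Section Smooth.
Context (R : realType) (V : normedModType R) (I : finType).
Variables (b : I -> V) (c : I -> {linear V -> R}).
Hypothesis frame : forall v, v = \sum_i c i v *: b i.
Hypothesis c_le : forall i v, `|c i v| <= `|v|.

Definition smooth (f : V -> R) := forall n, Cn n f.

Lemma smooth_diffable f : smooth f -> diffable f.
Proof. by move=> sf; apply: Cn_diffable (sf 1). Qed.

Lemma smooth_dird f v : smooth f -> smooth (dird v f).
Proof. by move=> sf n; apply: Cn_dird (sf n.+1). Qed.

Lemma smooth_dirds f vs : smooth f -> smooth (dirds vs f).
Proof. by elim: vs f => //= v vs IH f sf; apply/IH/smooth_dird. Qed.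

Lemma smoothD f g : smooth f -> smooth g -> smooth (fun x => f x + g x).
Proof. by move=> sf sg n; apply: CnD. Qed.

Lemma smoothM f g : smooth f -> smooth g -> smooth (fun x => f x * g x).
Proof. by move=> sf sg n; apply: CnM. Qed.

Lemma smoothZ (k : R) f : smooth f -> smooth (fun x => k * f x).
Proof. by move=> sf n; apply: CnZ. Qed.

Lemma smooth_cst (k : R) : smooth (fun=> k).
Proof. by move=> n; apply: Cn_cst. Qed.

Lemma smooth_sum (J : Type) (s : seq J) (Q : pred J) (f : J -> V -> R) :
  (forall j, Q j -> smooth (f j)) -> smooth (fun x =>
    \sum_(j <- s | Q j) f j x).
Proof. by move=> H n; apply: Cn_sum => j Qj; apply: H. Qed.

Lemma dirds_cat vs ws (f : V -> R) : dirds (vs ++ ws) f = dirds ws (dirds vs f).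
Proof. by elim: vs f => //= v vs IH f; rewrite IH. Qed.

Lemma dirdC_smooth f v w : smooth f -> dird v (dird w f) = dird w (dird v f).
Proof. by move=> sf; apply: (dirdC frame c_le). Qed.

Lemma dirds_dird f v vs : smooth f -> dirds vs (dird v f) = dird v (dirds vs f).
Proof.
by elim: vs f => //= w vs IH f sf; rewrite dirdC_smooth // IH //;
  apply: smooth_dird.
Qed.

Lemma dirdsD f g vs : smooth f -> smooth g ->
  dirds vs (fun x => f x + g x) = fun x => dirds vs f x + dirds vs g x.
Proof.
elim: vs f g => //= v vs IH f g sf sg.
rewrite dirdD; try exact: smooth_diffable.
by rewrite IH //; exact: smooth_dird.
Qed.

Lemma dirdsZ (k : R) f vs : smooth f ->
  dirds vs (fun x => k * f x) = fun x => k * dirds vs f x.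
Proof.
elim: vs f => //= v vs IH f sf.
rewrite dirdZ; last exact: smooth_diffable.
by rewrite IH //; exact: smooth_dird.
Qed.

Lemma dirds_suml f vs (J : Type) (s : seq J) (k : J -> R) (e : J ->
  V) : smooth f ->
  dirds vs (dird (\sum_(j <- s) k j *: e j) f) =
  fun x => \sum_(j <- s) k j * dirds vs (dird (e j) f) x.
Proof.
move=> sf; rewrite dirds_dird //; apply/funext => x; rewrite dird_suml.
by apply: eq_bigr => j _; rewrite dirds_dird.
Qed.

Lemma dirds_scale f (k : R) vs : smooth f ->
  dirds [seq k *: v | v <- vs] f = fun x => k ^+ size vs * dirds vs f x.
Proof.
elim: vs f => [|v vs IH] f sf /=.
  by apply/funext => x; rewrite expr0 mul1r.
rewrite IH; last exact: smooth_dird.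
have -> : dird (k *: v) f = fun x => k * dird v f x.
  by apply/funext => x; rewrite dirdZl.
rewrite dirdsZ; last exact: smooth_dird.
by apply/funext => x; rewrite exprSr mulrA.
Qed.

End Smooth.

Section SmoothComposition.
Context (R : realType) (V W : normedModType R) (L : {linear V -> W}).
Hypothesis cL : continuous L.

Let affL x v : L (x + v) = L x + L v. Proof. exact: linearD. Qed.

Lemma smooth_lincomp (f : W -> R) : smooth f -> smooth (fun x => f (L x)).
Proof. by move=> sf n; apply: (Cn_affine cL). Qed.

Lemma dirds_lincomp (f : W -> R) vs : smooth f ->
  dirds vs (fun x => f (L x)) = fun x => dirds (map L vs) f (L x).
Proof.
elim: vs f => //= v vs IH f sf.
rewrite -IH; last exact: smooth_dird.
by rewrite (dird_affine cL affL) //; exact: smooth_diffable.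
Qed.

End SmoothComposition.

(** * Division by a difference of coordinates *)

Section Division.
Context (R : realType) (d : nat).
Local Notation U := 'rV[R]_d.

Definition rcoord (i : 'I_d) (u : U) : R := u 0 i.

Fact rcoord_linear i : linear (rcoord i).
Proof. by move=> a u v; rewrite /rcoord !mxE. Qed.

HB.instance Definition _ i :=
  GRing.isLinear.Build R U R _ (rcoord i) (rcoord_linear i).

Lemma rcoord_frame (u : U) : u = \sum_i rcoord i u *: delta_mx 0 i.
Proof. exact: row_sum_delta. Qed.

Lemma rcoord_le i (u : U) : `|rcoord i u| <= `|u|.
Proof. exact: mx_entry_le. Qed.

Lemma rcoord_continuous i : continuous (rcoord i).
Proof. exact: coord_continuous. Qed.

Variables (i j : 'I_d).
Hypothesis ij : i != j.

(** The direction normal to the wall u_i = u_j, on which the linear form [l] vanishes. *)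
Let h : U := delta_mx 0 i - delta_mx 0 j.
Let l (u : U) : R := rcoord i u - rcoord j u.

Let lD u v : l (u + v) = l u + l v. Proof. by rewrite /l /rcoord !mxE;
  ring. Qed.
Let lZ a u : l (a *: u) = a * l u. Proof. by rewrite /l /rcoord !mxE; ring. Qed.
Let lh : l h = 2.
Proof.
rewrite /l /h !linearB /= /rcoord !mxE !eqxx [j == i]eq_sym (negbTE ij) /=;
  ring.
Qed.

Let sl : smooth l.
Proof.
move=> n; apply: CnB; apply: (@Cn_lin _ _ n (rcoord _));
  exact: rcoord_continuous.
Qed.

Let dird_l v : dird v l = fun=> l v.
Proof.
have -> : l = fun u => rcoord i u + (-1) * rcoord j u.
  by apply/funext => u; rewrite mulN1r.
have s k : smooth (rcoord k) by move=> n; apply: Cn_lin;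
  exact: rcoord_continuous.
have sd k : diffable (rcoord k) by exact: smooth_diffable.
rewrite dirdD //; last by apply: smooth_diffable; apply: smoothZ.
rewrite dirdZ // !dird_lin; try exact: rcoord_continuous.
by apply/funext => u; rewrite mulN1r.
Qed.

Lemma norm_transverse : `|h| <= 1.
Proof.
apply: mx_norm_leP => // a b; rewrite !mxE.
case: (b =P i) => [->|_]; first by rewrite andbT (negbTE ij) andbF subr0
  normr_nat lern1; case: (_ == _).
by rewrite andbF sub0r normrN normr_nat lern1; case: (_ && _).
Qed.

Lemma transverse_le u : `|l u| <= 2 * `|u|.
Proof.
apply: le_trans (ler_normB _ _) _.
by have := rcoord_le i u; have := rcoord_le j u; lra.
Qed.

Lemma iter_dird_div (g N : U -> R) r : smooth g -> (forall u,
  l u * g u = N u) ->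
  forall u, iter r.+1 (dird h) N u =
    l u * iter r.+1 (dird h) g u + 2 * r.+1%:R * iter r (dird h) g u.
Proof.
move=> sg E; have si k : smooth (iter k (dird h) g).
  by elim: k => //= k; apply: smooth_dird.
elim: r => [|r IH] u.
  have -> : N = fun u => l u * g u by apply/funext => v; rewrite E.
  rewrite /= dirdM; try exact: smooth_diffable.
  by rewrite dird_l lh; ring.
rewrite iterS.
have -> : iter r.+1 (dird h) N = fun u => l u * iter r.+1 (dird h) g u +
    2 * r.+1%:R * iter r (dird h) g u by apply/funext => v; rewrite IH.
rewrite dirdD; last 2 first.
- by apply: smooth_diffable; apply: smoothM.
- by apply: smooth_diffable; apply: smoothZ.
rewrite dirdM; try exact: smooth_diffable.
rewrite dird_l lh dirdZ; last exact: smooth_diffable.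
rewrite -!iterS -[r.+2%:R]natr1.
by move: (iter _ _ g u) (iter _ _ g u) => X Y; ring.
Qed.

(** The value at u is recovered by the mean value theorem on the segment joining u to the wall, with
    no loss in the constant or in the cube. *)
Lemma iter_div_bound (g N : U -> R) r (M B : R) : smooth g -> smooth N ->
  (forall u, l u * g u = N u) ->
  (forall u, `|u| <= M -> `|iter r.+1 (dird h) N u| <= B) ->
  forall u, `|u| <= M -> `|iter r (dird h) g u| <= B.
Proof.
move=> sg sN E HB u uM.
(* [u0] replaces the coordinates i and j of u by their mean. Every coordinate on the segment from
   [u0] to u is a convex combination of coordinates of u, so the segment stays in the cube. *)
pose s := l u / 2; pose u0 := u - s *: h.
have u0E : u = u0 + s *: h by rewrite subrK.
have lt t : l (u0 + t *: (s *: h)) = 2 * (t * s).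
  have E2 : l u = 2 * s by rewrite /s mulrC divfK // pnatr_eq0.
  by rewrite /u0 -scaleN1r !lD !lZ lh E2; ring.
have tM t : 0 <= t <= 1 -> `|u0 + t *: (s *: h)| <= M.
  move=> /andP[t0 t1]; apply: mx_norm_leP => [|a k].
    exact: le_trans uM.
  rewrite ord1 /u0 /s /l /rcoord !mxE.
  have ui := le_trans (rcoord_le i u) uM;
    have uj := le_trans (rcoord_le j u) uM.
  have uk := le_trans (rcoord_le k u) uM.
  move: ui uj uk; rewrite /rcoord !ler_norml /=.
  move=> /andP[ui1 ui2] /andP[uj1 uj2] /andP[uk1 uk2].
  case: (k =P i) => [->|_]; first rewrite (negbTE ij) /=.
    by apply/andP; split; nra.
  case: (k =P j) => [->|_] /=.
    by apply/andP; split; nra.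
  by rewrite !subrr !mulr0 subr0 addr0; apply/andP.
have si k : smooth (iter k (dird h) g) by elim: k => //= k; apply: smooth_dird.
(* Along the segment from the wall l = 0 to u, the derivative of k is
   t^r / 2 times the (r + 1)-st derivative of N, so no division by l occurs. *)
pose k (t : R) : R := t ^+ r.+1 * iter r (dird h) g (u0 + t *: (s *: h)).
have dk t : is_derive t (1 : R) k
    (2^-1 * t ^+ r * iter r.+1 (dird h) N (u0 + t *: (s *: h))).
  have D1 := is_derive_line (smooth_diffable (si r) (u0 + t *: (s *: h))).
  have D2 : is_derive t (1 : R) (fun t : R => t ^+ r.+1) (r.+1%:R * t ^+ r).
    split; first exact: exprn_derivable.
    by rewrite exp_derive /GRing.scale /= mulr1.
  have D3 := is_deriveM D2 D1.
  rewrite (iter_dird_div _ sg E) lt.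
  rewrite dirdZl in D3.
  apply: is_derive_eq D3 _.
  rewrite -!(mulrA 2^-1) iterS /GRing.scale /= exprS.
  have n2 : (2 : R) != 0 by rewrite pnatr_eq0.
  apply: (canRL (mulKf n2)).
  by move: (dird h _ _) (iter _ _ _ _) => X Y; ring.
have [|t t01 kE] := @MVT_segment R k
  (fun t => 2^-1 * t ^+ r * iter r.+1 (dird h) N (u0 + t *: (s *: h))) 0 1
    ler01.
  apply: continuous_subspaceT => t; apply: differentiable_continuous.
  by apply/derivable1_diffP; case: (dk t).
move: kE; rewrite /k expr1n expr0n mul0r mul1r !subr0 mulr1 scale1r -u0E => ->.
move: t01; rewrite in_itv /= => t01.
have HN := HB _ (tM _ t01).
rewrite normrM; apply: le_trans HN; rewrite ler_piMl //.
case/andP: t01 => t0 t1.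
rewrite normrM !ger0_norm ?exprn_ge0 ?invr_ge0 //.
by apply: mulr_ile1; rewrite ?invr_ge0 ?exprn_ge0 ?exprn_ile1 // invf_le1 //
  ler1n.
Qed.

Lemma dirds_nseq (V : normedModType R) (n : nat) (v : V) (f : V -> R) :
  dirds (nseq n v) f = iter n (dird v) f.
Proof. by elim: n f => //= n IH f; rewrite IH -iterSr. Qed.

(* A direction on which l vanishes commutes with the division by l, so it is
   enough to split off from every direction its component along h. *)
Lemma dirds_div_bound (a : seq U) r (g N : U -> R) (M B : R) :
  smooth g -> smooth N -> (forall u, l u * g u = N u) ->
  (forall ws, size ws = (size a + r.+1)%N -> all (fun w => `|w| <= 1) ws ->
     forall u, `|u| <= M -> `|dirds ws N u| <= B) ->
  all (fun w => `|w| <= 1) a ->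
  forall u, `|u| <= M -> `|dirds a (iter r (dird h) g) u| <= 3 ^+ size a * B.
Proof.
have dC := dirdC_smooth rcoord_frame rcoord_le.
elim: a r g N => [|v a IH] r g N sg sN E HB.
  move=> _ u uM; rewrite expr0 mul1r /=.
  apply: (iter_div_bound sg sN E _ uM) => w wM; rewrite -dirds_nseq.
  apply: HB wM; first by rewrite size_nseq.
  by rewrite all_nseq norm_transverse orbT.
move=> /= /andP[v1 a1] u uM.
(* Halving keeps the tangential part [w] in the unit ball. Then v = al h + 2 w with |al| <= 1, so
   each direction costs a factor 1 + 2 = 3. *)
pose al := l v / 2; pose w := 2^-1 *: (v - al *: h).
have lw : l w = 0.
  by rewrite /w lZ -scaleN1r !lD !lZ lh /al mulN1r divfK ?pnatr_eq0 // subrr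
    mulr0.
have al1 : `|al| <= 1.
  rewrite /al normrM normfV (ger0_norm (ler0n _ 2)) ler_pdivrMr // mul1r.
  by apply: le_trans (transverse_le v) _; lra.
have w1 : `|w| <= 1.
  rewrite /w normrZ normfV (ger0_norm (ler0n _ 2)) mulrC ler_pdivrMr // mul1r.
  apply: le_trans (ler_normB _ _) _; rewrite normrZ.
  have H1 : `|al| * `|h| <= 1 by rewrite mulr_ile1 // norm_transverse.
  by lra.
have si k : smooth (iter k (dird h) g) by elim: k => //= k; apply: smooth_dird.
have vE : v = al *: h + 2 *: w.
  by rewrite /w scalerA divff ?pnatr_eq0 // scale1r addrC subrK.
have -> : dird v (iter r (dird h) g) = fun u => al * iter r.+1 (dird h) g u +
    2 * iter r (dird h) (dird w g) u.
  have <- : dird w (iter r (dird h) g) = iter r (dird h) (dird w g).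
    by elim: (r) => //= k IHk; rewrite (dC _ _ _ (si k)) IHk.
  by apply/funext => z; rewrite {1}vE dirdDl !dirdZl.
have sw : smooth (iter r (dird h) (dird w g)).
  by elim: (r) => /= [|k IHk]; apply: smooth_dird.
rewrite dirdsD; try exact: smoothZ.
rewrite !dirdsZ //.
have A1 : `|dirds a (iter r.+1 (dird h) g) u| <= 3 ^+ size a * B.
  apply: (IH _ _ _ sg sN E _ a1 _ uM) => ws sz.
  by apply: HB; rewrite sz /= addnS.
have A2 : `|dirds a (iter r (dird h) (dird w g)) u| <= 3 ^+ size a * B.
  apply: (IH _ _ (dird w N)) a1 _ uM; try exact: smooth_dird.
    move=> z; have -> : N = fun u => l u * g u by apply/funext => y; rewrite E.
    by rewrite dirdM; try exact: smooth_diffable; rewrite dird_l lw mul0r add0r.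
  move=> ws sz ws1 z zM; apply: (HB (w :: ws)) => //=; first by rewrite sz.
  by rewrite w1.
apply: le_trans (ler_normD _ _) _; rewrite (normrM al) (normrM 2).
rewrite (ger0_norm (ler0n _ 2)) exprS -(mulrA 3).
have A3 : `|al| * `|dirds a (iter r.+1 (dird h) g) u| <= 3 ^+ size a * B.
  by apply: le_trans A1; rewrite ler_piMl.
apply: le_trans (lerD A3 (ler_wpM2l (ler0n _ 2) A2)) _.
by move: (3 ^+ _ * B) => Z; lra.
Qed.

End Division.

(** * A priori estimate *)

Section APriori.
Context (R : realType) (d : nat).
Local Notation S := (symmx R d).
Local Notation M := 'M[R]_d.
Local Notation U := 'rV[R]_d.
Local Notation small := (fun v => `|v| <= 1).

Definition scoord (ij : 'I_d * 'I_d) (x : S) : R := symval x ij.1 ij.2.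

Fact scoord_linear ij : linear (scoord ij).
Proof. by move=> a u v; rewrite /scoord !mxE. Qed.

HB.instance Definition _ ij :=
  GRing.isLinear.Build R S R _ (scoord ij) (scoord_linear ij).

Definition sbasis (ij : 'I_d * 'I_d) : S := symmetrize (delta_mx ij.1 ij.2).

Lemma scoord_frame (x : S) : x = \sum_ij scoord ij x *: sbasis ij.
Proof.
rewrite -{1}[x]symmetrizeK [symval x]matrix_sum_delta pair_bigA /= linear_sum.
by apply: eq_bigr => -[i j] _ /=; rewrite linearZ.
Qed.

Lemma scoord_le ij (x : S) : `|scoord ij x| <= `|x|.
Proof. exact: mx_entry_le. Qed.

Lemma scoord_continuous ij : continuous (scoord ij).
Proof.
apply: (@linear_le_continuous _ _ _ (scoord ij : {linear S -> R}) 1) => x.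
by rewrite mul1r scoord_le.
Qed.

Definition diagS (u : U) : S := symmetrize (diag_mx u).

Fact diagS_linear : linear diagS.
Proof. by move=> a u v; rewrite /diagS !linearP. Qed.

HB.instance Definition _ := GRing.isLinear.Build R U S _ diagS diagS_linear.

Lemma symval_diagS u : symval (diagS u) = diag_mx u.
Proof. by rewrite symval_symmetrize // tr_diag_mx. Qed.

Lemma diagS_le u : `|diagS u| <= `|u|.
Proof.
rewrite symnormE symval_diagS; apply: mx_norm_leP => // a b.
by rewrite mxE; case: eqP => _; rewrite ?mulr1n ?mulr0n ?normr0 // mx_entry_le.
Qed.

Lemma diagS_continuous : continuous diagS.
Proof.
by apply: (@linear_le_continuous _ _ _ (diagS : {linear U -> S}) 1) => u;
  rewrite mul1r; exact: diagS_le.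
Qed.

Lemma bracket_le i j (v : S) : `|bracket (rotgen R i j) v| <= 4 * `|v|.
Proof.
rewrite [leLHS]symnormE; apply: mx_norm_leP => [|k l];
  first by rewrite mulr_ge0.
rewrite bracketE.
have B (c : bool) p q : `|c%:R * symval v p q| <= `|v|.
  by case: c; rewrite ?mul1r ?mul0r ?normr0 // mx_entry_le.
have B' (c : bool) p q : `|symval v p q * c%:R| <= `|v| by rewrite mulrC.
apply: le_trans (ler_normB _ _) _.
apply: le_trans (lerD (ler_normB _ _) (ler_normB _ _)) _.
have := B (k == i) j l; have := B (k == j) i l.
have := B' (l == j) k i; have := B' (l == i) k j; lra.
Qed.

Lemma bracket_diagS i j (u : U) : i != j ->
  bracket (rotgen R i j) (diagS u) =
  (2 * (rcoord j u - rcoord i u)) *: sbasis (i, j).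
Proof.
move=> ij; apply: val_inj; apply/matrixP => k l.
rewrite [LHS]bracketE symval_diagS !mxE /rcoord /=.
have N : (i == j) = false by apply/negbTE.
have N' : (j == i) = false by rewrite eq_sym.
have K (m : 'I_d) : [\/ m = i, m = j | (m == i) = false /\ (m == j) = false].
  case: (m =P i) => [->|mi]; first by constructor 1.
  by case: (m =P j) => [->|mj]; [constructor 2|constructor 3].
have two : (2 : R) != 0 by rewrite pnatr_eq0.
case: (K k) => [->|->|[ki kj]]; case: (K l) => [->|->|[li lj]];
  rewrite ?eqxx ?N ?N' ?ki ?kj ?li ?lj 1?[i == l]eq_sym 1?[j == l]eq_sym ?li ?lj
    /= ?mulr0n ?mulr1n; by field.
Qed.

Section Bracket.
Variables (L : {linear S -> S}).
Hypothesis cL : continuous L.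

(* The sum over l of the iterated derivatives of P along vs with the l-th
   direction v replaced by L v. *)
Fixpoint lie (vs : seq S) (P : S -> R) : S -> R :=
  if vs is v :: ws then
    fun x => dird (L v) (dirds ws P) x + dird v (lie ws P) x
  else fun=> 0.

Lemma smooth_lie vs P : smooth P -> smooth (lie vs P).
Proof.
move=> sP; elim: vs => [|v vs IH] /=; first exact: smooth_cst.
by apply: smoothD; apply: smooth_dird => //; apply: smooth_dirds.
Qed.

(* Obtained by differentiating D_(L x) P (x) = 0 in x along vs. *)
Lemma lie_identity P : smooth P -> (forall x, dird (L x) P x = 0) ->
  forall vs x, dird (L x) (dirds vs P) x + lie vs P x = 0.
Proof.
move=> sP H vs; elim: vs => [|v vs IH] x /=; first by rewrite H addr0.
have DC := dirds_dird scoord_frame scoord_le; rewrite DC //.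
have dC := dirdC_smooth scoord_frame scoord_le.
set Q := dirds vs P; have sQ : smooth Q by apply: smooth_dirds.
have sl := smooth_lie vs sP.
have E : (fun x => dird (L x) Q x + lie vs P x) = fun=> 0.
  by apply/funext => y; rewrite IH.
(* The direction [L x] varies with x; in the frame its derivative becomes that of a sum of products.
   Differentiating the coefficients gives the term with [L v]. *)
have LE : (fun x => dird (L x) Q x) =
    fun x => \sum_ij scoord ij (L x) * dird (sbasis ij) Q x.
  by apply/funext => y; rewrite (dird_frame scoord_frame).
have sc0 ij : smooth (scoord ij).
  by move=> n; apply: Cn_lin; exact: scoord_continuous.
have sc ij : smooth (fun x => scoord ij (L x)) by apply: smooth_lincomp.
have dterm : smooth (fun x => dird (L x) Q x).
  rewrite LE; apply: smooth_sum => ij _; apply: smoothM => //;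
    exact: smooth_dird.
have := congr1 (fun f => dird v f x) E; rewrite dird_cst dirdD;
  try exact: smooth_diffable.
move=> <-; rewrite addrA; congr (_ + _).
rewrite LE dird_sum; last first.
  by move=> ij _; apply: smooth_diffable; apply: smoothM => //;
    exact: smooth_dird.
rewrite (dird_frame scoord_frame _ (L x)) (dird_frame scoord_frame _ (L v))
  -big_split /=.
apply: eq_bigr => ij _; rewrite dirdM; first last.
- by apply: smooth_diffable; apply: smooth_dird.
- exact: smooth_diffable.
have -> : dird v (fun y => scoord ij (L y)) = fun=> scoord ij (L v).
  rewrite (dird_affine (A := L) cL); [|exact: linearD|exact: smooth_diffable].
  by rewrite dird_lin //; exact: scoord_continuous.
by rewrite (dC _ _ _ sQ) addrC.
Qed.

(** There is one term for each element of [vs], and its modified direction [L v], of norm at most K,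
    is rescaled into the unit ball. The list [a] also collects the directions already peeled off in
    the induction. *)
Lemma lie_bound P (vs a : seq S) (x : S) (K B : R) : smooth P ->
  0 < K -> (forall v, `|L v| <= K * `|v|) -> 0 <= B ->
  (forall ws, size ws = size vs -> all small ws ->
     `|dirds (ws ++ a) P x| <= B) ->
  all small vs -> `|dirds a (lie vs P) x| <= (size vs)%:R * (K * B).
Proof.
move=> sP K0 LK B0; elim: vs a => [|v vs IH] a HB /=.
  move=> _; rewrite mul0r; have -> : dirds a (fun=> 0) = fun=> 0 :> R.
    by elim: a {HB} => //= w a IHa; rewrite dird_cst.
  by rewrite normr0.
move=> /andP[v1 vs1].
have sl := smooth_lie vs sP.
have sd := smooth_dirds vs sP.
rewrite dirdsD; try exact: smooth_dird.
apply: le_trans (ler_normD _ _) _; rewrite -natr1 mulrDl mul1r addrC.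
apply: lerD.
  apply: (IH (v :: a)) => // ws sz ws1; rewrite -cat_rcons; apply: HB.
    by rewrite size_rcons sz.
  by rewrite all_rcons v1.
have -> : L v = K *: (K^-1 *: L v) by rewrite scalerA divff ?gt_eqF // scale1r.
have sK : smooth (dird (K^-1 *: L v) (dirds vs P)) by apply: smooth_dird.
have -> : dird (K *: (K^-1 *: L v)) (dirds vs P) =
    fun x => K * dird (K^-1 *: L v) (dirds vs P) x.
  by apply/funext => z; rewrite dirdZl.
rewrite dirdsZ // normrM (gtr0_norm K0); apply: ler_wpM2l; first exact: ltW.
rewrite -(dirds_dird scoord_frame scoord_le) // -dirds_cat.
apply: (HB (_ :: vs)) => //=;
  rewrite vs1 andbT normrZ normfV (gtr0_norm K0) mulrC.
rewrite ler_pdivrMr // mul1r; apply: le_trans (LK v) _.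
by rewrite ger_pMr.
Qed.

End Bracket.

Lemma bracket_continuous (i j : 'I_d) : continuous (bracket (rotgen R i j)).
Proof.
apply: (@linear_le_continuous _ _ _ (bracket (rotgen R i j) : {linear S ->
  S}) 4).
exact: bracket_le.
Qed.

Lemma rotation_invariant_bracket (P : S -> R) (i j : 'I_d) (x : S) : i != j ->
  smooth P -> rotation_invariant P -> dird (bracket (rotgen R i j) x) P x = 0.
Proof.
move=> ij sP iP; have := is_derive_conj_rot x ij (smooth_diffable sP).
have -> : (fun t : R => P (symmetrize (planerot i j t *m symval x *m (planerot i
  j t)^T))) =
    fun=> P x.
  apply/funext => t; rewrite -(iP x _ (planerot_rotation ij t)); congr P.
  by rewrite -[RHS]symmetrizeK sym_conjE.
by move=> [_ <-]; rewrite derive_cst.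
Qed.

(** Induction on the number q of arbitrary directions, for all numbers p of diagonal ones. The first
    arbitrary direction is expanded in [sbasis]: a diagonal basis element joins [a], an off-diagonal
    one is exchanged for a diagonal derivative by [lie_identity] and division. Either way p + 1
    diagonal and q arbitrary directions remain. *)
Lemma diagonal_estimate q p : exists2 C : R, 0 <= C &
  forall (P : S -> R) (K A : R), smooth P -> rotation_invariant P -> 0 <= A ->
  (forall ws : seq U, size ws = (p + q)%N -> all small ws ->
    forall u, `|u| <= K -> `|dirds (map diagS ws) P (diagS u)| <= A) ->
  forall (a : seq U) (vs : seq S), size a = p -> size vs = q ->
    all small a -> all small vs -> forall u, `|u| <= K ->
    `|dirds (vs ++ map diagS a) P (diagS u)| <= C * A.
Proof.
elim: q p => [|q IH] p.
  exists 1 => // P K A sP iP A0 HA a [|//] sa _ a1 _ u uK.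
  by rewrite mul1r; apply: HA; rewrite // addn0.
have [C1 C10 HC1] := IH p.+1.
(* One summand per basis element: [C1] serves the diagonal ones. For the others, [3 ^+ p] comes from
   [dirds_div_bound], 1/2 from the factor 2 in the identity, q from the number of terms of [lie],
   and 4 from [bracket_le]. *)
exists (#|{: 'I_d * 'I_d}|%:R * (C1 + 3 ^+ p * (2^-1 * (q%:R * (4 * C1))))).
  by rewrite mulr_ge0 // addr_ge0 // !mulr_ge0 // ?exprn_ge0 // invr_ge0.
move=> P K A sP iP A0 HA a [//|v vs] sa [sv] a1 /= /andP[v1 vs1] u uK.
have {}HC1 := HC1 P K A sP iP A0.
have {}HC1 : forall (a : seq U) (vs : seq S), size a = p.+1 -> size vs = q ->
    all small a -> all small vs -> forall u, `|u| <= K ->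
    `|dirds (vs ++ map diagS a) P (diagS u)| <= C1 * A.
  by apply: HC1 => ws sw; apply: HA; rewrite sw addSnnS.
have D i j : `|dirds (vs ++ map diagS a) (dird (sbasis (i, j)) P) (diagS u)| <=
    (C1 + 3 ^+ p * (2^-1 * (q%:R * (4 * C1)))) * A.
  have [->|ij] := eqVneq i j.
    have -> : sbasis (j, j) = diagS (delta_mx 0 j).
      rewrite /sbasis /diagS; congr symmetrize; apply/matrixP => k l.
      rewrite !mxE /=; case: (k =P l) => [->|kl].
        by rewrite andbb mulr1n.
      rewrite mulr0n; case: (k =P j) => [kj|//]; case: (l =P j) => [lj|//].
      by case: kl; rewrite kj lj.
    rewrite mulrDl; apply: (@le_trans _ _ (C1 * A)); last first.
      by rewrite lerDl !mulr_ge0 // ?exprn_ge0 // invr_ge0.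
    rewrite dirds_cat (dirds_dird scoord_frame scoord_le) //.
    rewrite -[dirds _ _]/(dirds (map diagS (delta_mx 0 j :: a)) _) -dirds_cat.
    apply: HC1 => //=; first by rewrite sa.
    rewrite a1 andbT; apply: mx_norm_leP => // k l.
    by rewrite mxE normr_nat lern1; case: (_ && _).
  have ij' : i != j by exact: ij.
  set L := bracket (rotgen R i j).
  have sQ := smooth_dirds vs sP.
  have slie : smooth (lie L vs P) by apply: smooth_lie.
  pose g u := dird (sbasis (i, j)) (dirds vs P) (diagS u).
  pose N u := 2^-1 * lie L vs P (diagS u).
  have sg : smooth g by apply: (smooth_lincomp diagS_continuous);
    apply: smooth_dird.
  have sN0 : smooth (fun u => lie L vs P (diagS u)).
    by apply: (smooth_lincomp diagS_continuous).
  have sN : smooth N by apply: smoothZ.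
  have gN w : (rcoord i w - rcoord j w) * g w = N w.
    have /eqP := lie_identity (L := L) (@bracket_continuous i j) sP
      (fun x => rotation_invariant_bracket x ij sP iP) vs (diagS w).
    rewrite [X in dird X _ _](bracket_diagS w ij) dirdZl addrC addr_eq0 =>
      /eqP E.
    by rewrite /N E /g; move: (dird _ _ _) => G; field.
  have -> : dirds (vs ++ map diagS a) (dird (sbasis (i,
    j)) P) (diagS u) = dirds a g u.
    rewrite dirds_cat (dirds_dird scoord_frame scoord_le) //.
    have sb := smooth_dird (sbasis (i, j)) sQ.
    by rewrite /g (dirds_lincomp diagS_continuous a sb).
  apply: (@le_trans _ _ (3 ^+ size a * (2^-1 * (q%:R * (4 * (C1 * A)))))).
    apply: (dirds_div_bound (r := 0) ij' sg sN gN _ a1 uK) => ws sw ws1 w wK.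
    rewrite dirdsZ // normrM ger0_norm ?invr_ge0 // ler_wpM2l ?invr_ge0 //.
    rewrite (dirds_lincomp diagS_continuous) // -sv.
    apply: (lie_bound (L := L) (K := 4) (B := C1 * A)) => //.
    - by move=> z; exact: bracket_le.
    - by rewrite mulr_ge0.
    - by move=> zs sz zs1; apply: HC1; rewrite // ?sw ?addn1 ?sa // sz.
  rewrite sa [leRHS]mulrDl; have := mulr_ge0 C10 A0.
  by move: (3 ^+ p) => Z; rewrite -!(mulrA _ _ A) lerDr.
rewrite {1}[v]scoord_frame (dirds_suml scoord_frame scoord_le) //.
apply: le_trans (ler_norm_sum _ _ _) _.
rewrite -mulrA mulr_natl -sumr_const; apply: ler_sum => -[i j] _.
rewrite normrM; apply: le_trans (D i j); rewrite ler_piMl //.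
exact: le_trans (scoord_le _ _) v1.
Qed.

(** Each entry is a sum of d * d products in which the entries of g are at most 1; the summand 1
    makes the constant positive, so that one can divide by it. *)
Lemma sym_conj_le (g : M) (hg : is_rotation g) (x : S) :
  `|sym_conj hg x| <= ((d * d)%:R + 1) * `|x|.
Proof.
rewrite [leLHS]symnormE sym_conjE; apply: mx_norm_leP => [|i j].
  by rewrite mulr_ge0 // addr_ge0.
rewrite mulrDl mul1r; apply: (@le_trans _ _ ((d * d)%:R * `|x|));
  last by rewrite lerDl.
rewrite mxE; apply: le_trans (ler_norm_sum _ _ _) _.
have -> : (d * d)%:R * `|x| = \sum_(k < d) \sum_(l < d) `|x|.
  by rewrite !sumr_const !card_ord -mulrnA mulr_natl.
apply: ler_sum => k _; rewrite !mxE mulr_suml;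
  apply: le_trans (ler_norm_sum _ _ _) _.
apply: ler_sum => l _; rewrite !normrM -[leRHS]mulr1; apply: ler_pM => //;
  last exact: rotation_entry_le.
  rewrite -[leRHS]mul1r; apply: ler_pM => //; first exact: rotation_entry_le.
  exact: mx_entry_le.
Qed.

Lemma rotation_to_diagS (x : S) : exists (g : M) (hg : is_rotation g) (u : U),
  sym_conj hg x = diagS u /\ `|u| <= ((d * d)%:R + 1) * `|x|.
Proof.
have [g [hg dg]] := spectral x.
exists g, hg, (\row_i symval (sym_conj hg x) i i); split.
  apply: val_inj; rewrite [RHS]symval_diagS; apply/matrixP => i j.
  rewrite [RHS]mxE [X in X *+ _]mxE; case: eqP => [->|/eqP ij];
    first by rewrite mulr1n.
  by rewrite mulr0n; move/is_diag_mxP: dg; apply.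
apply: le_trans (sym_conj_le hg x); apply: mx_norm_leP => // i j.
by rewrite mxE mx_entry_le.
Qed.

(** A rotation diagonalizing x moves the directions along with the point. By [sym_conj_le] this
    enlarges the cube by the factor D = d * d + 1, and rescaling the q rotated directions
    contributes D^q. *)
Lemma invariant_estimate q : exists2 C : R, 0 <= C &
  forall (P : S -> R) (K A : R), smooth P -> rotation_invariant P -> 0 <= A ->
  (forall ws : seq U, size ws = q -> all small ws ->
    forall u, `|u| <= ((d * d)%:R + 1) * K ->
      `|dirds (map diagS ws) P (diagS u)| <= A) ->
  forall vs : seq S, size vs = q -> all small vs -> forall x, `|x| <= K ->
    `|dirds vs P x| <= C * A.
Proof.
have [C C0 HC] := diagonal_estimate q 0.
set D : R := (d * d)%:R + 1; have D0 : 0 < D by rewrite ltr_wpDl.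
exists (D ^+ q * C); first by rewrite mulr_ge0 // exprn_ge0 // ltW.
move=> P K A sP iP A0 HA vs sv vs1 x xK.
have [g [hg [u [xu uD]]]] := rotation_to_diagS x.
have cg : continuous (sym_conj hg).
  by apply: (@linear_le_continuous _ _ _ (sym_conj hg : {linear S ->
    S}) D) => v;
    exact: sym_conj_le.
have -> : dirds vs P x = dirds (map (sym_conj hg) vs) P (diagS u).
  rewrite -xu -[RHS](congr1 (fun f => f x) (dirds_lincomp cg vs sP)).
  by congr (dirds vs _ x); apply/funext => y; rewrite iP.
have -> : map (sym_conj hg) vs = [seq D *: v | v <- [seq D^-1 *: sym_conj hg v |
  v <- vs]].
  by rewrite -map_comp; apply: eq_map => v /=;
    rewrite scalerA divff ?gt_eqF // scale1r.
rewrite dirds_scale // size_map sv normrM.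
rewrite (ger0_norm (exprn_ge0 _ (ltW D0))) -mulrA.
apply: ler_wpM2l; first by rewrite exprn_ge0 // ltW.
have {}HC ws := HC P (D * K) A sP iP A0 HA [::] ws erefl.
rewrite -[X in dirds X]cats0; apply: HC => //.
- by rewrite size_map.
- rewrite all_map; apply: sub_all vs1 => v /= v1.
  rewrite normrZ normfV (gtr0_norm D0) mulrC ler_pdivrMr // mul1r.
  by apply: le_trans (sym_conj_le hg v) _; rewrite ger_pMr.
- by apply: le_trans uD _; rewrite ler_wpM2l // ltW.
Qed.

End APriori.

(** * Invariant extensions of symmetric polynomials *)

Section Ryser.
Context (R : comNzRingType) (d : nat).

(** The sign (-1)^(d - |I|), as a product so that it distributes over sums on subsets. *)
Definition ryser_sign (I : {set 'I_d}) : R :=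
  \prod_i (if i \in I then 1 else -1).

(** Ryser's formula for the permanent, by inclusion-exclusion. Expanding the product gives a sum
    over maps f, and the signed count of the sets I containing the image of f factors over i into 1
    - [i not in the image]: it is 1 when f is onto, hence a permutation, and 0 otherwise. *)
Lemma ryser_formula (F : 'I_d -> 'I_d -> R) :
  \sum_(I : {set 'I_d}) ryser_sign I * \prod_j \sum_(i in I) F i j =
  \sum_(s : 'S_d) \prod_j F (s j) j.
Proof.
have E I : \prod_j \sum_(i in I) F i j =
    \sum_(f : {ffun 'I_d -> 'I_d})
      (\prod_j (f j \in I)%:R) * \prod_j F (f j) j.
  under eq_bigr => j _ do rewrite big_mkcond.
  rewrite (bigA_distr_bigA (fun j i => if i \in I then F i j else 0)).
  apply: eq_bigr => f _; rewrite -big_split /=; apply: eq_bigr => j _.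
  by case: ifP; rewrite ?mul1r ?mul0r.
under eq_bigr => I _ do rewrite E mulr_sumr.
rewrite exchange_big /=.
have W (f : {ffun 'I_d -> 'I_d}) :
    \sum_(I : {set 'I_d}) ryser_sign I * ((\prod_j (f j \in I)%:R) * \prod_j F
      (f j) j) =
    (injectiveb f)%:R * \prod_j F (f j) j.
  transitivity (\sum_(I : {set 'I_d}) (ryser_sign I * \prod_j (f j \in I)%:R) *
      \prod_j F (f j) j); first by apply: eq_bigr => I _; rewrite mulrA.
  rewrite -mulr_suml; congr (_ * _).
  transitivity (\sum_(I in {set 'I_d})
     \prod_i (if i \in I then 1 else - (i \notin codom f)%:R : R)).
    apply: eq_big => // I _.
    have -> : \prod_j (f j \in I)%:R =
        \prod_i (if i \in I then 1 else (i \notin codom f)%:R) :> R.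
      case: (boolP [forall j, f j \in I]) => [/forallP fI|].
        rewrite !big1 // => [i _|j _]; last by rewrite fI.
        by case: ifP => // iI; case: codomP => // -[j ij]; rewrite ij fI in iI.
      rewrite negb_forall => /existsP[j fj].
      rewrite (bigD1 j) //= (negbTE fj) mul0r (bigD1 (f j)) //= (negbTE fj).
      by rewrite codom_f mul0r.
    rewrite /ryser_sign -big_split /=; apply: eq_bigr => i _.
    by case: ifP; rewrite ?mul1r ?mulN1r.
  rewrite -bigA_distr /=.
  case: (boolP (injectiveb f)) => [/injectiveP fi|].
    rewrite big1 // => i _.
    by have -> : i \in codom f; [exact: inj_card_onto|rewrite subr0].
  move=> fni; have [i ni] : exists i, i \notin codom f.
    apply/existsP; rewrite -negb_forall; apply: contra fni => /forallP fs.
    apply: (leq_size_uniq (enum_uniq 'I_d)) => [i _|]; first exact: fs.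
    by rewrite size_map.
  by rewrite (bigD1 i) //= ni subrr mul0r.
under eq_bigr => f _ do rewrite W.
rewrite (bigID (fun f : {ffun 'I_d -> 'I_d} =>
  injectiveb f)) /= addrC big1 ?add0r.
  rewrite (reindex (@pval _)) /=; last first.
    pose in_Sn := insubd (1%g : 'S_d).
    by exists in_Sn => /= f Uf; first apply: val_inj; apply: insubdK.
  apply: eq_big => /= [s | s _]; first exact: (valP s).
  by rewrite (valP s) mul1r; apply: eq_bigr => j _; rewrite pvalE.
by move=> f /negbTE ->; rewrite mul0r.
Qed.

End Ryser.

Section Lift.
Context (R : realType) (d : nat).
Local Notation S := (symmx R d).
Local Notation M := 'M[R]_d.
Local Notation U := 'rV[R]_d.

Inductive polyfun : (U -> R) -> Prop :=
| polyfun_cst (c : R) : polyfun (fun=> c)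
| polyfun_coord i : polyfun (rcoord i)
| polyfunD f g : polyfun f -> polyfun g -> polyfun (fun u => f u + g u)
| polyfunM f g : polyfun f -> polyfun g -> polyfun (fun u => f u * g u).

Definition monomial (a : {ffun 'I_d -> nat}) (u : U) : R :=
  \prod_i rcoord i u ^+ a i.

Lemma polyfun_monomials g : polyfun g ->
  exists l : seq (R * {ffun 'I_d -> nat}),
    forall u, g u = \sum_(ca <- l) ca.1 * monomial ca.2 u.
Proof.
elim=> {g} [c|i|f g _ [l fl] _ [m gm]|f g _ [l fl] _ [m gm]].
- exists [:: (c, [ffun=> 0%N])] => u;
  rewrite big_seq1 /monomial big1 ?mulr1 // => i _.
  by rewrite ffunE expr0.
- exists [:: (1, [ffun j => (j == i : nat)])] => u.
  rewrite big_seq1 mul1r /monomial (bigD1 i) //= ffunE eqxx expr1 big1 ?mulr1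
    //.
  by move=> j ji; rewrite ffunE (negbTE ji) expr0.
- by exists (l ++ m) => u; rewrite big_cat fl gm.
pose mm (ca cb : R * {ffun 'I_d -> nat}) :=
  (ca.1 * cb.1, [ffun i => (ca.2 i + cb.2 i)%N] : {ffun 'I_d -> nat}).
exists [seq mm ca cb | ca <- l, cb <- m] => u.
rewrite fl gm big_allpairs_dep /= mulr_suml; apply: eq_bigr => ca _.
rewrite mulr_sumr; apply: eq_bigr => cb _.
rewrite mulrACA; congr (_ * _); rewrite /monomial -big_split /=.
by apply: eq_bigr => i _; rewrite ffunE exprD.
Qed.

Definition mxpow (y : M) k : M := iter k (mulmx y) 1%:M.

Lemma mxpow_conj (g y : M) k : g^T *m g = 1%:M -> g *m g^T = 1%:M ->
  mxpow (g *m y *m g^T) k = g *m mxpow y k *m g^T.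
Proof.
move=> gg gg'; elim: k => [|k IH] /=; first by rewrite mulmx1.
by rewrite -/(mxpow _ k) IH !mulmxA -(mulmxA _ g^T g) gg mulmx1.
Qed.

Lemma mxpow_diag (u : U) k : mxpow (diag_mx u) k = diag_mx (\row_i u 0 i ^+ k).
Proof.
elim: k => [|k IH] /=; first by apply/matrixP => i j; rewrite !mxE expr0.
rewrite -/(mxpow _ k) IH mulmx_diag; congr diag_mx; apply/rowP => i.
by rewrite !mxE exprS.
Qed.

Definition liftmx (a : {ffun 'I_d -> nat}) (I : {set 'I_d}) (y : M) : M :=
  \sum_(i in I) mxpow y (a i).

(* Polarization of the determinant: on diagonal matrices Ryser's formula turns
   it into the symmetrized monomial. *)
Definition lift_monomial (a : {ffun 'I_d -> nat}) (x : S) : R :=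
  \sum_(I : {set 'I_d}) ryser_sign R I * \det (liftmx a I (symval x)).

Lemma smooth_lift_monomial a : smooth (lift_monomial a).
Proof.
move=> n; have ce i j : Cn n (fun x : S => symval x i j).
  exact: (Cn_lin n (f := scoord (i, j)) (@scoord_continuous _ _ (i, j))).
have cp k i j : Cn n (fun x : S => mxpow (symval x) k i j).
  elim: k i j => [|k IH] i j; first exact: Cn_cst.
  have -> : (fun x : S => mxpow (symval x) k.+1 i j) =
      fun x => \sum_l symval x i l * mxpow (symval x) k l j.
    by apply/funext => x; rewrite mxE.
  by apply: Cn_sum => l _; apply: CnM.
apply: Cn_sum => I _; apply: CnZ; apply: Cn_sum => s _; apply: CnZ.
apply: Cn_prod => i _.
have -> : (fun x : S => liftmx a I (symval x) i (s i)) =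
    fun x => \sum_(l in I) mxpow (symval x) (a l) i (s i).
  by apply/funext => x; rewrite summxE.
by apply: Cn_sum => l _.
Qed.

Lemma lift_monomial_invariant a : rotation_invariant (lift_monomial a).
Proof.
move=> x g hg; apply: eq_bigr => I _; congr (_ * _).
have -> : liftmx a I (symval (sym_conj hg x)) = g *m liftmx a I (symval x) *m
  g^T.
  rewrite /liftmx mulmx_sumr mulmx_suml; apply: eq_bigr => i _.
  rewrite sym_conjE mxpow_conj //; first exact: rotation_mulVmx.
  by case/andP: hg => /eqP.
rewrite !det_mulmx det_tr mulrAC; case/andP: hg => _ /eqP ->.
by rewrite !mul1r.
Qed.

Lemma lift_monomial_diag a (u : U) :
  lift_monomial a (diagS u) = \sum_(s : 'S_d) monomial a (col_perm s u).
Proof.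
transitivity (\sum_(I : {set 'I_d}) ryser_sign R I *
    \prod_j \sum_(i in I) u 0 j ^+ a i).
  apply: eq_bigr => I _; congr (_ * _); rewrite symval_diagS /liftmx.
  have -> : \sum_(i in I) mxpow (diag_mx u) (a i) =
      diag_mx (\sum_(i in I) \row_j u 0 j ^+ a i).
    by rewrite linear_sum; apply: eq_bigr => i _; exact: mxpow_diag.
  rewrite det_diag; apply: eq_bigr => j _.
  by rewrite summxE; apply: eq_bigr => i _; rewrite mxE.
(* Ryser's formula permutes the exponents; inverting s and reindexing the product moves the
   permutation to the coordinates. *)
rewrite (ryser_formula (fun i j =>
  u 0 j ^+ a i)) (reindex_inj (@invg_inj {perm 'I_d})) /=.
apply: eq_bigr => s _; rewrite /monomial (reindex_inj (@perm_inj _ s)) /=.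
by apply: eq_bigr => i _; rewrite permK /rcoord mxE.
Qed.

Lemma polyfun_lift g : polyfun g -> exists P : S -> R,
  [/\ smooth P, rotation_invariant P &
      forall u, P (diagS u) = \sum_(s : 'S_d) g (col_perm s u)].
Proof.
case/polyfun_monomials => l gl.
exists (fun x => \sum_(ca <- l) ca.1 * lift_monomial ca.2 x); split.
- by apply: smooth_sum => ca _; apply: smoothZ; exact: smooth_lift_monomial.
- move=> x g' hg; apply: eq_bigr => ca _; congr (_ * _).
  exact: lift_monomial_invariant.
move=> u; under [RHS]eq_bigr => s _ do rewrite gl.
rewrite exchange_big; apply: eq_bigr => ca _.
by rewrite lift_monomial_diag mulr_sumr.
Qed.

End Lift.

(** * Bernstein operators *)

Section DeCasteljau.
Context (R : realType).

(* De Casteljau's recursion for the value at t of the Bernstein polynomial of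
   degree m with coefficients c 0, ..., c m. *)
Fixpoint casteljau m (c : nat -> R) (t : R) : R :=
  if m is m'.+1 then
    (1 - t) * casteljau m' c t + t * casteljau m' (fun k => c k.+1) t
  else c 0.

Lemma casteljau_linear m (c c' : nat -> R) (a a' : R) t :
  casteljau m (fun k => a * c k + a' * c' k) t =
  a * casteljau m c t + a' * casteljau m c' t.
Proof. by elim: m c c' => //= m IH c c'; rewrite !IH; ring. Qed.

Lemma casteljau_cst m (a t : R) : casteljau m (fun=> a) t = a.
Proof. by elim: m => //= m ->; ring. Qed.

Lemma casteljau_le m (c c' : nat -> R) t : 0 <= t <= 1 ->
  (forall k, (k <= m)%N -> c k <= c' k) -> casteljau m c t <= casteljau m c' t.
Proof.
move=> /andP[t0 t1]; elim: m c c' => [|m IH] c c' cc' /=; first exact: cc'.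
apply: lerD; apply: ler_wpM2l; rewrite ?subr_ge0 //; apply: IH => k km;
  apply: cc' => //.
exact: leqW.
Qed.

Lemma casteljau_norm m (c c' : nat -> R) t : 0 <= t <= 1 ->
  (forall k, (k <= m)%N -> `|c k| <= c' k) ->
    `|casteljau m c t| <= casteljau m c' t.
Proof.
move=> t01 cc'; rewrite ler_norml; apply/andP; split; last first.
  by apply: casteljau_le => // k /cc'; exact: le_trans (ler_norm _).
rewrite lerNl; have := casteljau_linear m c c (-1) 0 t.
rewrite mul0r addr0 mulN1r => <-.
apply: casteljau_le => // k /cc'; apply: le_trans.
by rewrite mul0r addr0 mulN1r -normrN ler_norm.
Qed.

(** For t in [0, 1], [casteljau m c t] is the expectation of c at a binomial variable with
    parameters m and t; this is its mean, and the next lemma its second moment. *)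
Lemma casteljau_moment1 m t : casteljau m (fun k => k%:R) t = m%:R * t.
Proof.
elim: m => [|m IH] /=; first by rewrite mul0r.
have -> : (fun k => k.+1%:R : R) = fun k => 1 * k%:R + 1 * 1.
  by apply/funext => k; rewrite !mul1r natr1.
by rewrite (casteljau_linear m (fun k =>
  k%:R) (fun=> 1)) IH casteljau_cst -natr1; ring.
Qed.

Lemma casteljau_moment2 m t : casteljau m (fun k => k%:R ^+ 2) t =
  m%:R * t * (1 - t) + (m%:R * t) ^+ 2.
Proof.
elim: m => [|m IH] /=; first by ring.
have -> : (fun k => k.+1%:R ^+ 2 : R) =
    fun k => 1 * k%:R ^+ 2 + 1 * (2 * k%:R + 1 * 1).
  by apply/funext => k; rewrite -natr1; ring.
rewrite (casteljau_linear m (fun k => k%:R ^+ 2) (fun k => 2 * k%:R + 1 * 1)).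
rewrite (casteljau_linear m (fun k => k%:R) (fun=> 1)).
by rewrite IH casteljau_moment1 casteljau_cst -natr1; ring.
Qed.

(** The left side is the variance m t (1 - t) / N^2 plus the squared bias (t (N - m) / N)^2, the
    bias being due to a degree m below the mesh N. *)
Lemma casteljau_variance m N t : (0 < N)%N -> (m <= N)%N -> 0 <= t <= 1 ->
  casteljau m (fun k => (k%:R / N%:R - t) ^+ 2) t <=
  (1 + (N - m)%:R ^+ 2) / N%:R.
Proof.
move=> N0 mN /andP[t0 t1].
have Np : 0 < N%:R :> R by rewrite ltr0n.
have -> : (fun k => (k%:R / N%:R - t) ^+ 2 : R) = fun k =>
    (N%:R ^- 2) * k%:R ^+ 2 + 1 * ((- 2 * t / N%:R) * k%:R + t ^+ 2 * 1).
  by apply/funext => k; field; rewrite gt_eqF.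
rewrite (casteljau_linear m (fun k => k%:R ^+ 2)
  (fun k => (- 2 * t / N%:R) * k%:R + t ^+ 2 * 1)).
rewrite (casteljau_linear m (fun k => k%:R) (fun=> 1)).
rewrite casteljau_moment1 casteljau_moment2 casteljau_cst natrB //.
set n : R := N%:R; set p : R := m%:R.
have p0 : 0 <= p by rewrite ler0n.
have pn : p <= n by rewrite ler_nat.
have n1 : 1 <= n by rewrite ler1n.
have -> : n ^- 2 * (p * t * (1 - t) + (p * t) ^+ 2) +
    1 * (-2 * t / n * (p * t) + t ^+ 2 * 1) =
    (p * t * (1 - t) + t ^+ 2 * (n - p) ^+ 2) / n ^+ 2.
  by field; rewrite gt_eqF.
rewrite ler_pdivrMr ?exprn_gt0 //.
have -> : (1 + (n - p) ^+ 2) / n * n ^+ 2 = (1 + (n - p) ^+ 2) * n.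
  by field; rewrite gt_eqF.
have A1 : p * t * (1 - t) <= n by nra.
have A2 : t ^+ 2 * (n - p) ^+ 2 <= (n - p) ^+ 2 * n.
  rewrite mulrC ler_wpM2l ?sqr_ge0 //; nra.
by rewrite mulrDl mul1r; apply: lerD.
Qed.

End DeCasteljau.

(** * Uniform continuity on cubes *)

Section UniformContinuity.
Context (R : realType) (d : nat).
Local Notation U := 'rV[R]_d.

Lemma cube_compact (K : R) : compact [set u : U | `|u| <= K].
Proof.
apply: bounded_closed_compact.
  exists K; split; first exact: num_real.
  by move=> x Kx u /= uK; apply: le_trans uK (ltW Kx).
apply: (@closed_comp _ _ (fun u : U => `|u|) [set x | x <= K]) => [u _|].
  exact: norm_continuous.
exact: closed_le.
Qed.

(** Uniform continuity in a form that can be averaged against a variance: points closer than r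
    differ by at most e in value, and for the others a bound 2 B is at most (2 B / r^2) |v -
    u|^2. *)
Lemma quadratic_modulus (g : U -> R) (K e : R) : continuous g -> 0 < e ->
  exists2 C : R, 0 <= C & forall u v : U, `|u| <= K -> `|v| <= K ->
    `|g v - g u| <= e + C * `|v - u| ^+ 2.
Proof.
move=> cg e0.
have [B B0 gB] : exists2 B : R, 0 <= B & forall u : U, `|u| <= K -> `|g u| <= B.
  have /compact_bounded : compact (g @` [set u : U | `|u| <= K]).
    by apply: continuous_compact;
      [exact: continuous_subspaceT|exact: cube_compact].
  move=> [B [_ HB]]; exists (`|B| + 1); first by rewrite addr_ge0.
  move=> u uK; apply: (HB (`|B| + 1)) => /=; last by exists u.
  by rewrite (le_lt_trans (ler_norm B)) // ltrDl.
have : \forall r \near (0 : R)^'+, [set u : U | `|u| <= K] `<=`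
    (fun u => forall v, `|v - u| <= r -> `|g v - g u| <= e).
  apply: (compact_near_coveringP _).1 (@cube_compact K) _ _ _ _ _ => x _.
  have e20 : 0 < e / 2 by rewrite divr_gt0.
  have /cvgrPdist_le/(_ _ e20)/nbhs_ballP[r /= r0 Hr] := cg x.
  have r20 : 0 < r / 2 by rewrite divr_gt0.
  exists (ball x (r / 2), [set s | s < r / 2]) => /=.
    split; first exact: nbhsx_ballx.
    by apply: nbhs_right_lt.
  move=> [y s] /= [xy sr] v vy.
  have H1 : `|g x - g y| <= e / 2.
    by apply: Hr; apply: le_ball xy; lra.
  have H2 : `|g x - g v| <= e / 2.
    apply: Hr; rewrite -ball_normE /=; move: xy; rewrite -ball_normE /= => xy.
    have -> : x - v = (x - y) - (v - y) by rewrite opprB addrA subrK.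
    by apply: le_lt_trans (ler_normB _ _) _; lra.
  have -> : g v - g y = (g x - g y) - (g x - g v) by ring.
  by apply: le_trans (ler_normB _ _) _; lra.
move=> Hr; have [r /andP[r0 Hr']] : exists r : R, (0 < r) && `[< forall u : U,
  `|u| <= K ->
    forall v, `|v - u| <= r -> `|g v - g u| <= e >].
  near (0 : R)^'+ => r; exists r; apply/andP; split; first by near: r;
    exact: nbhs_right_gt.
  by apply/asboolP; near: r.
move/asboolP in Hr'.
have HC : 0 <= 2 * B / r ^+ 2 by apply: divr_ge0;
  [exact: mulr_ge0|exact: sqr_ge0].
exists (2 * B / r ^+ 2) => //.
move=> u v uK vK; have [vr|rv] := leP `|v - u| r.
  by apply: le_trans (Hr' _ uK _ vr) _; rewrite lerDl; apply: mulr_ge0;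
    last exact: sqr_ge0.
apply: (@le_trans _ _ (2 * B)).
  by apply: le_trans (ler_normB _ _) _; have := gB _ uK; have := gB _ vK; lra.
rewrite -[leLHS]add0r; apply: lerD; first exact: ltW.
rewrite -mulrA ler_peMr ?mulr_ge0 // mulrC ler_pdivlMr ?exprn_gt0 // mul1r.
by rewrite lerXn2r ?nnegrE // ltW.
Unshelve. all: by end_near. Qed.

End UniformContinuity.

Section Bernstein.
Context (R : realType) (d : nat).
Local Notation U := 'rV[R]_d.
Local Notation e j := (delta_mx 0 j : U).
Variables (i : 'I_d) (K : R).
Hypothesis K0 : 0 < K.

(* The affine map sending [- K, K] in the i-th coordinate onto [0, 1]. *)
Definition slope (u : U) : R := (2 * K)^-1 * rcoord i u + 2^-1.

Lemma smooth_rcoord j : smooth (@rcoord R d j).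
Proof. by move=> n; apply: Cn_lin; exact: rcoord_continuous. Qed.

Lemma dird_rcoord j v : dird v (@rcoord R d j) = fun=> rcoord j v.
Proof. by rewrite dird_lin //; exact: rcoord_continuous. Qed.

Lemma smooth_slope : smooth slope.
Proof.
by apply: smoothD; [apply: smoothZ; exact: smooth_rcoord|exact: smooth_cst].
Qed.

Lemma dird_slope v : dird v slope = fun=> (2 * K)^-1 * rcoord i v.
Proof.
have sc := smooth_rcoord i.
rewrite /slope dirdD; first last.
- exact: smooth_diffable (smooth_cst _ _).
- by apply: smooth_diffable; apply: smoothZ.
rewrite dirdZ; last exact: smooth_diffable.
by rewrite dird_cst dird_rcoord; apply/funext => u; rewrite addr0.
Qed.

(** The coefficients are functions, so that the coordinates other than the i-th stay free and can be
    differentiated under the operator. *)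
Definition blend m (c : nat -> U -> R) (u : U) : R :=
  casteljau m (fun k => c k u) (slope u).

Lemma blendS m c : blend m.+1 c = fun u =>
  (1 + (-1) * slope u) * blend m c u + slope u * blend m (fun k => c k.+1) u.
Proof. by apply/funext => u; rewrite mulN1r. Qed.

Let s1 : smooth (fun u => 1 + (-1) * slope u).
Proof.
by apply: smoothD; [exact: smooth_cst|apply: smoothZ; exact: smooth_slope].
Qed.

Let ds1 v : dird v (fun u =>
  1 + (-1) * slope u) = fun=> - ((2 * K)^-1 * rcoord i v).
Proof.
have ss := smooth_slope.
rewrite dirdD; first last.
- by apply: smooth_diffable; apply: smoothZ.
- exact: smooth_diffable (smooth_cst _ _).
rewrite dirdZ; last exact: smooth_diffable.
by rewrite dird_cst dird_slope; apply/funext => u; rewrite add0r mulN1r.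
Qed.

Lemma Cn_blend n m c : (forall k, Cn n (c k)) -> Cn n (blend m c).
Proof.
elim: m c => [|m IH] c cc; first exact: cc.
rewrite blendS; apply: CnD; apply: CnM; try exact: IH; first exact: s1.
exact: smooth_slope.
Qed.

Lemma diffable_blend m c : (forall k, diffable (c k)) -> diffable (blend m c).
Proof.
elim: m c => [|m IH] c cc; first exact: cc.
rewrite blendS; apply: diffableD; apply: diffableM; try exact: IH.
  exact: smooth_diffable.
exact: smooth_diffable smooth_slope.
Qed.

Lemma dird_blendS m c v : (forall k, diffable (c k)) ->
  dird v (blend m.+1 c) = fun u =>
    (2 * K)^-1 * rcoord i v * (blend m (fun k => c k.+1) u - blend m c u) +
    ((1 + (-1) * slope u) * dird v (blend m c) u +
     slope u * dird v (blend m (fun k => c k.+1)) u).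
Proof.
move=> cc; rewrite blendS.
have d1 := smooth_diffable s1; have d2 := smooth_diffable smooth_slope.
have d3 := diffable_blend m cc.
have d4 : diffable (blend m (fun k => c k.+1)) by apply: diffable_blend.
rewrite dirdD; [|exact: diffableM|exact: diffableM].
rewrite (dirdM v d1 d3) (dirdM v d2 d4) ds1 dird_slope; apply/funext => u.
move: (slope u) (blend m c u) (blend m _ u) (dird v _ u) (dird v _ u) =>
  s X Y Z W.
by move: (_^-1 * _) => k; ring.
Qed.

Lemma dird_blend_transverse m c v : rcoord i v = 0 -> (forall k,
  diffable (c k)) ->
  dird v (blend m c) = blend m (fun k => dird v (c k)).
Proof.
move=> v0; elim: m c => [//|m IH] c cc.
rewrite dird_blendS // v0 !IH // blendS.
by apply/funext => u; rewrite mulr0 mul0r add0r.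
Qed.

Lemma blend_sub m c c' u :
  blend m (fun k u => c k u - c' k u) u = blend m c u - blend m c' u.
Proof.
have := casteljau_linear m (fun k => c k u) (fun k => c' k u) 1 (-1) (slope u).
rewrite mul1r mulN1r /blend => <-; congr (casteljau _ _ _).
by apply/funext => k; rewrite mul1r mulN1r.
Qed.

Lemma blend_scale m (a : R) c u : blend m (fun k u =>
  a * c k u) u = a * blend m c u.
Proof.
have := casteljau_linear m (fun k => c k u) (fun k => c k u) a 0 (slope u).
rewrite mul0r addr0 /blend => <-; congr (casteljau _ _ _).
by apply/funext => k; rewrite mul0r addr0.
Qed.

(** The classical derivative formula: forward differences of the coefficients, one degree lower,
    times the degree. Coefficients constant along v leave only the contribution of [slope]. *)
Lemma dird_blend_along m c v : (forall k, diffable (c k)) ->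
  (forall k, dird v (c k) = fun=> 0) ->
  dird v (blend m.+1 c) = fun u => m.+1%:R * ((2 * K)^-1 * rcoord i v) *
    blend m (fun k u => c k.+1 u - c k u) u.
Proof.
elim: m c => [|m IH] c cc c0; rewrite dird_blendS //.
  by apply/funext => u; rewrite /blend /= !c0; ring.
rewrite !IH //; apply/funext => u.
rewrite -[in RHS]natr1 -blend_sub blendS /=.
move: (slope u) (blend m _ u) (blend m _ u) => s X Y.
by move: (_^-1 * _) => k; ring.
Qed.

Definition substc (y : R) (u : U) : U := u + (y - rcoord i u) *: e i.

(** The linear part of the affine map [substc y], the same for every y. *)
Definition dropc (v : U) : U := v - rcoord i v *: e i.

Fact dropc_linear : linear dropc.
Proof.
by move=> a u v; apply/rowP => k; rewrite /dropc /rcoord !mxE; ring.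
Qed.

HB.instance Definition _ := GRing.isLinear.Build R U U _ dropc dropc_linear.

Lemma basis_le j : `|e j| <= 1.
Proof.
by apply: mx_norm_leP => // a b; rewrite mxE normr_nat lern1; case: (_ && _).
Qed.

Lemma rcoord_basis j k : rcoord j (e k) = (j == k)%:R.
Proof. by rewrite /rcoord mxE eqxx. Qed.

Lemma dropc_continuous : continuous dropc.
Proof.
apply: (@linear_le_continuous _ _ _ (dropc : {linear U -> U}) 2) => v.
apply: le_trans (ler_normB _ _) _; rewrite normrZ.
have H : `|rcoord i v| * `|e i| <= `|v| * 1 by apply: ler_pM => //;
  [exact: rcoord_le|exact: basis_le].
by lra.
Qed.

Lemma substcD y u v : substc y (u + v) = substc y u + dropc v.
Proof.
by apply/rowP => k; rewrite /substc /dropc /rcoord !mxE; ring.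
Qed.

Lemma dropc_basis j : dropc (e j) = if j == i then 0 else e j.
Proof.
rewrite /dropc rcoord_basis eq_sym; case: eqP => [->|_].
  by rewrite scale1r subrr.
by rewrite scale0r subr0.
Qed.

Lemma Cn_substc n (f : U -> R) y : Cn n f -> Cn n (fun u => f (substc y u)).
Proof. by move=> cf; apply: (Cn_affine dropc_continuous (substcD y)). Qed.

Lemma diffable_substc (f : U -> R) y : diffable f -> diffable (fun u =>
  f (substc y u)).
Proof. exact: (diffable_affine dropc_continuous (substcD y)). Qed.

Lemma dird_substc (f : U -> R) y v : diffable f ->
  dird v (fun u => f (substc y u)) = fun u => dird (dropc v) f (substc y u).
Proof. exact: (dird_affine dropc_continuous (substcD y)). Qed.

(** The value of the i-th coordinate at which [slope] equals k / N. *)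
Definition node N k : R := K * (2 * (k%:R / N%:R) - 1).

(* The degree m and the mesh N are independent because differentiating in the
   i-th coordinate lowers the former only. *)
Definition bernstein m N (f : U -> R) : U -> R :=
  blend m (fun k u => f (substc (node N k) u)).

(** The step 2 K / N is the distance between consecutive nodes, so forward differences of Bernstein
    coefficients are multiples of [diffquot] at the nodes. *)
Definition diffquot N (f : U -> R) (u : U) : R :=
  (N%:R / (2 * K)) * (f (u + (2 * K / N%:R) *: e i) - f u).

Lemma Cn_bernstein n m N f : Cn n f -> Cn n (bernstein m N f).
Proof. by move=> cf; apply: Cn_blend => k; apply: Cn_substc. Qed.

Lemma dird_bernstein_transverse m N f j : j != i -> diffable f ->
  dird (e j) (bernstein m N f) = bernstein m N (dird (e j) f).
Proof.
move=> ji df.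
have v0 : rcoord i (e j) = 0 by rewrite rcoord_basis eq_sym (negbTE ji).
have dc k : diffable (fun u =>
  f (substc (node N k) u)) by apply: diffable_substc.
have E : (fun k => dird (e j) (fun u => f (substc (node N k) u))) =
      fun k u => dird (e j) f (substc (node N k) u).
  apply/funext => k; rewrite dird_substc //.
  by rewrite dropc_basis (negbTE ji).
have B := dird_blend_transverse m v0 dc; rewrite E in B.
exact: B.
Qed.

(** The derivative is again a Bernstein operator with the same mesh, so the formula can be iterated;
    its factor (m + 1) / N tends to 1 as long as N - m stays bounded. *)
Lemma dird_bernstein_along m N f : (0 < N)%N -> diffable f ->
  dird (e i) (bernstein m.+1 N f) =
  bernstein m N (fun u => (m.+1%:R / N%:R) * diffquot N f u).
Proof.
move=> N0 df; have Np : (N%:R : R) != 0 by rewrite pnatr_eq0 -lt0n.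
rewrite /bernstein dird_blend_along; first last.
- move=> k; rewrite dird_substc // dropc_basis eqxx; apply/funext => u.
  exact: linear0.
- by move=> k; apply: diffable_substc.
apply/funext => u; rewrite -blend_scale; congr (casteljau _ _ _).
apply/funext => k; rewrite /diffquot.
have -> : substc (node N k) u + (2 * K / N%:R) *: e i = substc (node N k.+1) u.
  rewrite /substc -addrA -scalerDl; congr (_ + _ *: _).
  rewrite /node -[k.+1%:R]natr1; field; exact: Np.
rewrite rcoord_basis eqxx mulr1 mulrA; congr (_ * _).
by field; rewrite Np gt_eqF.
Qed.

Lemma slope01 u : `|u| <= K -> 0 <= slope u <= 1.
Proof.
move=> uK; have := le_trans (rcoord_le i u) uK;
  rewrite ler_norml => /andP[u1 u2].
have E : slope u = (rcoord i u + K) / (2 * K) by rewrite /slope; field;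
  rewrite gt_eqF.
have K20 : 0 < 2 * K by rewrite mulr_gt0.
rewrite E; apply/andP; split.
  by apply: divr_ge0; [lra|exact: ltW].
by rewrite ler_pdivrMr // mul1r; lra.
Qed.

Lemma node_le N k : (k <= N)%N -> (0 < N)%N -> `|node N k| <= K.
Proof.
move=> kN N0; have Np : 0 < N%:R :> R by rewrite ltr0n.
have q0 : 0 <= k%:R / N%:R :> R by rewrite divr_ge0.
have q1 : k%:R / N%:R <= 1 :> R by rewrite ler_pdivrMr // mul1r ler_nat.
rewrite /node ler_norml; set q := _ / _ in q0 q1 *.
have := mulr_ge0 (ltW K0) q0; have := ler_wpM2l (ltW K0) q1; rewrite mulr1.
by move=> H1 H2; apply/andP; split; lra.
Qed.

Lemma substc_le y u : `|u| <= K -> `|y| <= K -> `|substc y u| <= K.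
Proof.
move=> uK yK; apply: mx_norm_leP => [|a k]; first exact: ltW.
rewrite ord1 /substc !mxE /=; case: (k =P i) => [->|_].
  by rewrite mulr1 /rcoord addrC subrK.
by rewrite mulr0 addr0; apply: le_trans uK; exact: mx_entry_le.
Qed.

Lemma node_dist N k u : `|substc (node N k) u - u| <=
  2 * K * `|k%:R / N%:R - slope u|.
Proof.
rewrite /substc addrC addKr normrZ.
have -> : node N k - rcoord i u = 2 * K * (k%:R / N%:R - slope u).
  by rewrite /node /slope; set q : R := _ / N%:R; field; rewrite gt_eqF.
rewrite normrM (gtr0_norm (_ : 0 < 2 * K)) ?mulr_gt0 //.
by rewrite ler_piMr ?basis_le // !mulr_ge0 // ltW.
Qed.

(** Bernstein's argument: the quadratic modulus of g is averaged over the nodes, and the mean square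
    distance to u is O(1 / N) because degree and mesh differ by the fixed number a. *)
Lemma bernstein_converges (fN : nat -> U -> R) (g : U -> R) a : continuous g ->
  (forall r : R, 0 < r -> \forall N \near \oo, forall u, `|u| <= K ->
     `|fN N u - g u| <= r) ->
  forall r : R, 0 < r -> \forall N \near \oo, forall u, `|u| <= K ->
     `|bernstein (N - a) N (fN N) u - g u| <= r.
Proof.
move=> cg fg r r0.
have r30 : 0 < r / 3 by rewrite divr_gt0.
have [C C0 HC] := quadratic_modulus K cg r30.
pose D : R := C * (2 * K) ^+ 2 * (1 + a%:R ^+ 2).
have CK0 : 0 <= C * (2 * K) ^+ 2 by apply: mulr_ge0 => //; exact: sqr_ge0.
have D0 : 0 <= D by apply: mulr_ge0 => //; apply: addr_ge0 => //;
  exact: sqr_ge0.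
near=> N => u uK.
have N0 : (0 < N)%N by near: N; exists 1%N.
have aN : (a <= N)%N by near: N; exists a.
have ND : D / N%:R <= r / 3.
  rewrite ler_pdivrMr ?ltr0n // -ler_pdivrMl // ; near: N;
    exact: nbhs_infty_ger.
have t01 := slope01 uK.
have -> : bernstein (N - a) N (fN N) u - g u =
    blend (N - a) (fun k u => fN N (substc (node N k) u) - g u) u.
  rewrite (blend_sub _ (fun k u => fN N (substc (node N k) u)) (fun k => g)).
  by rewrite /(blend _ (fun=> g)) casteljau_cst.
apply: (@le_trans _ _ (casteljau (N - a)
  (fun k => 1 * (r / 3 + r / 3) + C * (2 * K) ^+ 2 * (k%:R / N%:R - slope u) ^+
    2) (slope u))).
  apply: casteljau_norm => // k kNa.
  have kN : (k <= N)%N by apply: leq_trans kNa (leq_subr _ _).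
  have yK := node_le kN N0; have sK := substc_le uK yK.
  rewrite mul1r; apply: le_trans (ler_distD (g (substc (node N k) u)) _ _) _.
  rewrite -addrA; apply: lerD.
    have : forall u, `|u| <= K -> `|fN N u - g u| <= r / 3 by near: N;
      exact: fg.
    exact.
  apply: le_trans (HC _ _ uK sK) _; rewrite lerD2l -mulrA ler_wpM2l //.
  rewrite -[(_ - slope u) ^+ 2]real_normK ?num_real // -exprMn.
  rewrite lerXn2r ?nnegrE ?mulr_ge0 // ?(ltW K0) //.
  exact: node_dist.
rewrite (casteljau_linear _ (fun=> r / 3 + r / 3)) casteljau_cst mul1r.
have := casteljau_variance N0 (leq_subr a N) t01; rewrite subKn // => V.
have : C * (2 * K) ^+ 2 * casteljau (N - a) (fun k =>
  (k%:R / N%:R - slope u) ^+ 2) (slope u)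
    <= D / N%:R.
  by rewrite /D -(mulrA (C * _)) ler_wpM2l.
lra.
Unshelve. all: by end_near. Qed.

End Bernstein.

(** * C^n approximation by polynomials *)

Section CnConvergence.
Context (R : realType) (d : nat).
Local Notation U := 'rV[R]_d.
Local Notation e j := (delta_mx 0 j : U).

Definition ucv (K : R) (fN : nat -> U -> R) (g : U -> R) : Prop :=
  forall r : R, 0 < r -> \forall N \near \oo, forall u, `|u| <= K ->
    `|fN N u - g u| <= r.

Fixpoint cvn (K : R) n (fN : nat -> U -> R) (g : U -> R) : Prop :=
  ucv K fN g /\
  if n is m.+1 then
    forall j, cvn K m (fun N => dird (e j) (fN N)) (dird (e j) g)
  else True.

Lemma cvn_ucv K n fN g : cvn K n fN g -> ucv K fN g.
Proof. by case: n => [[]|n []]. Qed.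

Lemma cvn_dird K n fN g j : cvn K n.+1 fN g ->
  cvn K n (fun N => dird (e j) (fN N)) (dird (e j) g).
Proof. by case=> _; apply. Qed.

Lemma cvn_near K n fN hN g : (\forall N \near \oo, fN N = hN N) ->
  cvn K n fN g -> cvn K n hN g.
Proof.
have U0 fN' hN' g' : (\forall N \near \oo,
  fN' N = hN' N) -> ucv K fN' g' -> ucv K hN' g'.
  by move=> E F r r0; near=> N; have <- : fN' N = hN' N; near: N => //;
    exact: F.
elim: n fN hN g => [|n IH] fN hN g E [F G]; split => //; try exact: U0 E F.
move=> j; apply: IH (G j); apply: filterS E => N; exact: congr1.
Unshelve. all: by end_near. Qed.

Lemma cvn_cst K n g : cvn K n (fun=> g) g.
Proof.
have U0 g' : ucv K (fun=> g') g'.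
  by move=> r r0; apply: nearW => N u _; rewrite subrr normr0 ltW.
by elim: n g => [|n IH] g; split.
Qed.

Lemma ucv_scale (K : R) (rN : nat -> R) fN (g : U -> R) : continuous g ->
  rN @ \oo --> (1 : R) -> ucv K fN g -> ucv K (fun N u => rN N * fN N u) g.
Proof.
move=> cg r1 F r r0.
(* Comparison with the value at 0 bounds g on the cube; the absolute value of K ensures that 0 lies
   in it. *)
have [C C0 HC] := quadratic_modulus `|K| cg (@ltr01 R).
pose B : R := `|g 0| + (1 + C * `|K| ^+ 2).
have B0 : 0 <= B.
  by rewrite !addr_ge0 // mulr_ge0 // sqr_ge0.
have gB u : `|u| <= K -> `|g u| <= B.
  move=> uK; have uK' : `|u| <= `|K| by apply: le_trans uK (ler_norm _).
  have := HC 0 u; rewrite normr0 subr0 => /(_ (normr_ge0 _) uK') H.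
  rewrite /B -[g u](subrK (g 0)) addrC; apply: le_trans (ler_normD _ _) _.
  rewrite addrC [leRHS]addrC; apply: lerD => //; apply: le_trans H _.
  by rewrite lerD2l ler_wpM2l // lerXn2r ?nnegrE.
have r40 : 0 < r / 4 by rewrite divr_gt0.
have rB : 0 < r / (2 * (B + 1)) by rewrite divr_gt0 // mulr_gt0 // ltr_wpDl.
near=> N => u uK.
have F1 : forall u, `|u| <= K -> `|fN N u - g u| <= r / 4 by near: N; exact: F.
have R1 : `|rN N - 1| <= 1.
  near: N; have /cvgrPdist_le/(_ _ ltr01) := r1.
  by apply: filterS => N; rewrite distrC.
have R2 : `|rN N - 1| <= r / (2 * (B + 1)).
  near: N; have /cvgrPdist_le/(_ _ rB) := r1.
  by apply: filterS => N; rewrite distrC.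
rewrite (_ : _ - _ = (rN N - 1) * (fN N u - g u) + (fN N u - g u) + (rN N - 1) *
  g u); last by ring.
apply: le_trans (ler_normD _ _) _;
  apply: le_trans (lerD (ler_normD _ _) (lexx _)) _.
rewrite !normrM.
have A1 : `|rN N - 1| * `|fN N u - g u| <= 1 * (r / 4) by apply: ler_pM => //;
  exact: F1.
have A2 : `|rN N - 1| * `|g u| <= r / (2 * (B + 1)) * B by apply: ler_pM => //;
  exact: gB.
have A3 : r / (2 * (B + 1)) * B <= r / 2.
  rewrite mulrAC ler_pdivrMr ?mulr_gt0 ?ltr_wpDl //.
  rewrite mulrA divfK ?pnatr_eq0 // ler_wpM2l ?(ltW r0) // lerDl //.
have := F1 _ uK; lra.
Unshelve. all: by end_near. Qed.

Lemma cvn_scale K n (rN : nat -> R) fN (g : U -> R) : (forall N, Cn n (fN N)) ->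
  Cn n g -> rN @ \oo --> (1 : R) -> cvn K n fN g -> cvn K n (fun N u =>
    rN N * fN N u) g.
Proof.
move=> cf cg r1; elim: n fN g cf cg => [|n IH] fN g cf cg [F G]; split => //;
  try by apply: ucv_scale F => //; exact: Cn_continuous cg.
move=> j; have -> : (fun N => dird (e j) (fun u => rN N * fN N u)) =
    fun N u => rN N * dird (e j) (fN N) u.
  by apply/funext => N; rewrite dirdZ //; exact: Cn_diffable (cf N).
apply: IH; [|exact: Cn_dird|exact: G].
by move=> N; exact: (Cn_dird (e j) (cf N)).
Qed.

Section OneCoordinate.
Variables (i : 'I_d) (K : R).
Hypothesis K0 : 0 < K.

Let cid : continuous (idfun : U -> U). Proof. by move=> u; exact: cvg_id. Qed.
Let shiftD (w u v : U) : (u + v) + w = (u + w) + v. Proof. by rewrite addrAC.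
  Qed.

Lemma Cn_diffquot n N f : Cn n f -> Cn n (diffquot i K N f).
Proof.
move=> cf; apply: CnZ; apply: CnB => //.
exact: (Cn_affine (L := idfun) cid (shiftD _) cf).
Qed.

Lemma dird_diffquot v N f : diffable f ->
  dird v (diffquot i K N f) = diffquot i K N (dird v f).
Proof.
move=> df.
have ds : diffable (fun u => f (u + (2 * K / N%:R) *: e i)).
  exact: (diffable_affine (L := idfun) cid (shiftD _) df).
have dn : diffable (fun u => (-1) * f u).
  by apply: diffableM => // u; exact: differentiable_cst.
have -> : diffquot i K N f = fun u => (N%:R / (2 * K)) *
    (f (u + (2 * K / N%:R) *: e i) + (-1) * f u).
  by apply/funext => u; rewrite mulN1r.
rewrite dirdZ; last exact: diffableD.
rewrite dirdD // dirdZ // (dird_affine (L := idfun) cid (shiftD _)) //.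
by apply/funext => u; rewrite mulN1r.
Qed.

(** The quotient looks up to 2 K beyond the cube of radius K', which is why convergence is assumed
    on all cubes. *)
Lemma ucv_diffquot fN (g : U -> R) : (forall N, diffable (fN N)) ->
  continuous (dird (e i) g) ->
  (forall K', ucv K' (fun N => dird (e i) (fN N)) (dird (e i) g)) ->
  forall K', ucv K' (fun N => diffquot i K N (fN N)) (dird (e i) g).
Proof.
move=> df cg F K' r r0.
have r30 : 0 < r / 3 by rewrite divr_gt0.
have [C C0 HC] := quadratic_modulus (K' + 2 * K) cg r30.
have K20 : 0 < 2 * K by rewrite mulr_gt0.
have D0 : 0 <= C * (2 * K) ^+ 2 by rewrite mulr_ge0 // sqr_ge0.
near=> N => u uK.
have N0 : (0 < N)%N by near: N; exists 1%N.
have N1 : 1 <= N%:R :> R by rewrite ler1n.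
have Np : 0 < N%:R :> R by rewrite ltr0n.
have ND : C * (2 * K) ^+ 2 / N%:R <= r / 3.
  by rewrite ler_pdivrMr // -ler_pdivrMl //; near: N; exact: nbhs_infty_ger.
have [h hE] : exists h : R, h = 2 * K / N%:R by exists (2 * K / N%:R).
have h0 : 0 < h by rewrite hE divr_gt0.
have hK : h <= 2 * K by rewrite hE ler_pdivrMr // ler_peMr // ltW.
have [t /andP[t0 t1] E] := mvt_line u (h *: e i) (df N).
have -> : diffquot i K N (fN N) u = dird (e i) (fN N) (u + t *: (h *: e i)).
  by rewrite /diffquot -hE E dirdZl hE; field; rewrite !gt_eqF.
set v := u + _.
have vu : `|v - u| <= h.
  rewrite /v addrC addKr !normrZ (ger0_norm t0) (gtr0_norm h0).
  rewrite mulrCA ler_piMr ?(ltW h0) // mulr_ile1 //; exact: basis_le.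
have vK : `|v| <= K' + 2 * K.
  rewrite -[v](subrK u); apply: le_trans (ler_normD _ _) _; lra.
have uK' : `|u| <= K' + 2 * K by lra.
have A1 : `|dird (e i) (fN N) v - dird (e i) g v| <= r / 3.
  have : forall w, `|w| <= K' + 2 * K ->
      `|dird (e i) (fN N) w - dird (e i) g w| <= r / 3 by near: N; exact: F.
  exact.
have A2 := HC u v uK' vK.
have A3 : C * `|v - u| ^+ 2 <= C * (2 * K) ^+ 2 / N%:R.
  rewrite -mulrA ler_wpM2l //; apply: (@le_trans _ _ (h ^+ 2)).
    by rewrite lerXn2r ?nnegrE // ltW.
  rewrite hE expr_div_n ler_wpM2l ?sqr_ge0 // lef_pV2 ?posrE ?exprn_gt0 //.
  by rewrite expr2 ler_peMr // ltW.
apply: le_trans (ler_distD (dird (e i) g v) _ _) _.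
apply: le_trans (lerD A1 A2) _.
have r3 : r = r / 3 + (r / 3 + r / 3) by field.
by rewrite [leRHS]r3 !lerD2l; exact: le_trans A3 ND.
Unshelve. all: by end_near. Qed.

Lemma cvn_diffquot n fN (g : U -> R) : (forall N,
  Cn n.+1 (fN N)) -> Cn n.+1 g ->
  (forall K', cvn K' n.+1 fN g) ->
  forall K', cvn K' n (fun N => diffquot i K N (fN N)) (dird (e i) g).
Proof.
elim: n fN g => [|n IH] fN g cf cg F K'.
  split => //; apply: ucv_diffquot => [N||K''].
  - exact: Cn_diffable (cf N).
  - exact: Cn_continuous (Cn_dird (e i) cg).
  - exact: cvn_ucv (cvn_dird i (F K'')).
split.
  apply: ucv_diffquot => [N||K''].
  - exact: Cn_diffable (cf N).
  - exact: Cn_continuous (Cn_dird (e i) cg).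
  - exact: cvn_ucv (cvn_dird i (F K'')).
move=> j.
have -> : (fun N => dird (e j) (diffquot i K N (fN N))) =
    fun N => diffquot i K N (dird (e j) (fN N)).
  by apply/funext => N; rewrite dird_diffquot //; exact: Cn_diffable (cf N).
rewrite (dirdC (@rcoord_frame R d) (@rcoord_le R d));
  last exact: (Cn_le (n := n.+2) _ cg).
apply: IH; [|exact: Cn_dird|].
  by move=> N; exact: (Cn_dird (e j) (cf N)).
by move=> K''; exact: cvn_dird (F K'').
Qed.

(** A sequence [fN] and a degree defect a are needed for the induction: a derivative along
    coordinate i replaces [fN N] by a scaled difference quotient depending on N and raises a by
    one. *)
Lemma cvn_bernstein n fN (g : U -> R) a : (forall N, Cn n (fN N)) -> Cn n g ->
  (forall K', cvn K' n fN g) ->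
  cvn K n (fun N => bernstein i K (N - a) N (fN N)) g.
Proof.
elim: n fN g a => [|n IH] fN g a cf cg F.
  by split => //; apply: bernstein_converges => //; exact: cvn_ucv (F K).
split.
  by apply: bernstein_converges => //;
    [exact: Cn_continuous cg|exact: cvn_ucv (F K)].
move=> j; have [->|ji] := eqVneq j i; last first.
  have -> : (fun N => dird (e j) (bernstein i K (N - a) N (fN N))) =
      fun N => bernstein i K (N - a) N (dird (e j) (fN N)).
    apply/funext => N; rewrite dird_bernstein_transverse //.
    exact: Cn_diffable (cf N).
  apply: IH; [|exact: Cn_dird|].
    by move=> N; exact: (Cn_dird (e j) (cf N)).
  by move=> K'; exact: cvn_dird (F K').
pose r N : R := (N - a)%:R / N%:R.
have r1 : r @ \oo --> (1 : R).
  apply/cvgrPdist_le => s s0; near=> N.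
  have aN : (a <= N)%N by near: N; exists a.
  have N0 : (0 < N)%N by near: N; exists 1%N.
  have as' : a%:R / s <= N%:R by near: N; exact: nbhs_infty_ger.
  have Np : 0 < N%:R :> R by rewrite ltr0n.
  have -> : 1 - r N = a%:R / N%:R by rewrite /r natrB //; field; rewrite gt_eqF.
  rewrite ger0_norm ?divr_ge0 // ler_pdivrMr // -ler_pdivrMl // mulrC //.
(* The derivative formula needs a degree that is a successor, and N - a is one only for N > a. *)
apply: (@cvn_near _ _ (fun N => bernstein i K (N - a.+1) N
    (fun u => r N * diffquot i K N (fN N) u))).
  near=> N; have aN : (a < N)%N by near: N; exists a.+1.
  have N0 : (0 < N)%N by apply: leq_ltn_trans aN.
  have E : (N - a = (N - a.+1).+1)%N by rewrite subnSK.
  rewrite /r E; apply/esym/dird_bernstein_along => //.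
  exact: Cn_diffable (cf N).
apply: IH; [|exact: Cn_dird|].
  by move=> N; apply: CnZ; apply: Cn_diffquot; exact: CnW.
move=> K'; apply: cvn_scale => //; last exact: cvn_diffquot.
  by move=> N; apply: Cn_diffquot; exact: CnW.
exact: Cn_dird.
Unshelve. all: by end_near. 
Qed.

End OneCoordinate.
End CnConvergence.

(** * Approximation by polynomials in all coordinates *)

Section PolynomialApproximation.
Context (R : realType) (d : nat).
Local Notation U := 'rV[R]_d.
Local Notation e j := (delta_mx 0 j : U).
Local Notation small := (fun v => `|v| <= 1).

(* Functions polynomial in the coordinates of index < j, arbitrary in
   the others. *)
Inductive poly_before (j : nat) : (U -> R) -> Prop :=
| poly_before_base f : (forall u v,
    (forall k : 'I_d, (j <= k)%N -> rcoord k u = rcoord k v) -> f u = f v) ->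
    poly_before j f
| poly_before_coord k : poly_before j (rcoord k)
| poly_beforeD f g : poly_before j f -> poly_before j g ->
    poly_before j (fun u => f u + g u)
| poly_beforeM f g : poly_before j f -> poly_before j g ->
    poly_before j (fun u => f u * g u).

Lemma poly_before_cst j (c : R) : poly_before j (fun=> c).
Proof. by constructor 1. Qed.

Lemma poly_before0 f : poly_before 0 f.
Proof.
constructor 1 => u v uv; congr f; apply/rowP => k; exact: uv.
Qed.

Lemma poly_before_polyfun f : poly_before d f -> polyfun f.
Proof.
elim=> {f} [f H|k|f g _ pf _ pg|f g _ pf _ pg].
- have -> : f = fun=> f 0.
    by apply/funext => u; apply: H => k; rewrite leqNgt ltn_ord.
  exact: polyfun_cst.
- exact: polyfun_coord.
- exact: polyfunD.
- exact: polyfunM.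
Qed.

(** Freezing coordinate i leaves the arbitrary part dependent on coordinates beyond i only, and
    turns [rcoord i] into a constant. *)
Lemma poly_before_substc (i : 'I_d) f y : poly_before i f ->
  poly_before i.+1 (fun u => f (substc i y u)).
Proof.
have E k u : rcoord k (substc i y u) = if k == i then y else rcoord k u.
  rewrite /substc /rcoord !mxE /=; case: eqP => [->|_].
    by rewrite mulr1 addrC subrK.
  by rewrite mulr0 addr0.
elim=> {f} [f H|k|f g _ pf _ pg|f g _ pf _ pg].
- constructor 1 => u v uv; apply: H => k ik; rewrite !E.
  case: eqP => // /eqP ki; apply: uv.
  by rewrite ltn_neqAle ik andbT eq_sym.
- have [->|ki] := eqVneq k i.
    have -> : (fun u => rcoord i (substc i y u)) = fun=> y.
      by apply/funext => u; rewrite E eqxx.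
    exact: poly_before_cst.
  have -> : (fun u => rcoord k (substc i y u)) = rcoord k.
    by apply/funext => u; rewrite E (negbTE ki).
  exact: poly_before_coord.
- exact: poly_beforeD.
- exact: poly_beforeM.
Qed.

Lemma poly_before_blend (i : 'I_d) j K m (c : nat -> U -> R) :
  (forall k, poly_before j (c k)) -> poly_before j (blend i K m c).
Proof.
have ps : poly_before j (@slope R d i K).
  apply: poly_beforeD; last exact: poly_before_cst.
  by apply: poly_beforeM; [exact: poly_before_cst|exact: poly_before_coord].
elim: m c => [|m IH] c pc; first exact: (pc 0%N).
rewrite blendS; apply: poly_beforeD; apply: poly_beforeM => //; try exact: IH.
apply: poly_beforeD; first exact: poly_before_cst.
by apply: poly_beforeM => //; exact: poly_before_cst.
Qed.

Lemma poly_before_bernstein (i : 'I_d) K m N f : poly_before i f ->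
  poly_before i.+1 (bernstein i K m N f).
Proof. by move=> pf; apply: poly_before_blend => k;
  apply: poly_before_substc. Qed.

Fixpoint Cn_close (K : R) n (r : R) (f g : U -> R) : Prop :=
  (forall u, `|u| <= K -> `|f u - g u| <= r) /\
  if n is m.+1 then forall j,
    Cn_close K m r (dird (e j) f) (dird (e j) g) else True.

Lemma cvn_close K n fN (g : U -> R) r : 0 < r -> cvn K n fN g ->
  \forall N \near \oo, Cn_close K n r (fN N) g.
Proof.
move=> r0; elim: n fN g => [|n IH] fN g [F G].
  by apply: filterS (F r r0) => N HN; exact: (conj HN I).
have : \forall N \near \oo, forall j,
  Cn_close K n r (dird (e j) (fN N)) (dird (e j) g).
  by apply: filter_forall => j; exact: (IH _ _ (G j)).
by apply: filterS2 (F r r0) => N HN HN'; exact: (conj HN HN').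
Qed.

Lemma Cn_close_refl K n r f : 0 <= r -> Cn_close K n r f f.
Proof.
move=> r0; elim: n f => [|n IH] f; split=> //;
  by move=> u _; rewrite subrr normr0.
Qed.

Lemma Cn_close_trans K n r s f g h : Cn_close K n r f g -> Cn_close K n s g h ->
  Cn_close K n (r + s) f h.
Proof.
have T (f' g' h' : U -> R) : (forall u, `|u| <= K -> `|f' u - g' u| <= r) ->
    (forall u, `|u| <= K -> `|g' u - h' u| <= s) ->
    forall u, `|u| <= K -> `|f' u - h' u| <= r + s.
  move=> A B u uK; apply: le_trans (ler_distD (g' u) _ _) _.
  by apply: lerD; [exact: A|exact: B].
elim: n f g h => [|n IH] f g h [A A'] [B B']; split => //; try exact: T A B.
by move=> j; apply: IH (A' j) (B' j).
Qed.

Lemma polynomial_approximation n (f : U -> R) (K r : R) : Cn n f ->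
  0 < K -> 0 < r -> exists2 p, polyfun p & Cn_close K n r p f.
Proof.
move=> cf K0 r0.
suff H j : (j <= d)%N -> forall r : R, 0 < r ->
    exists p, [/\ Cn n p, poly_before j p & Cn_close K n r p f].
  have [p [_ pp pf]] := H d (leqnn d) r r0.
  by exists p => //; apply: poly_before_polyfun.
elim: j => [|j IH] jd s s0.
  by exists f; split => //; [exact: poly_before0|apply: Cn_close_refl;
    exact: ltW].
(* Half of the error is for the earlier coordinates. The operator in coordinate j is then applied to
   the fixed function [p], with mesh chosen after it to use the other half. *)
have s20 : 0 < s / 2 by rewrite divr_gt0.
have [p [cp pp pf]] := IH (ltnW jd) _ s20.
pose i := Ordinal jd.
have B := cvn_bernstein i K0 0%N (fun=> cp) cp (fun K' => cvn_cst K' n p).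
have [N _ HN] := cvn_close s20 B.
have {}HN := HN N (leqnn N).
exists (bernstein i K (N - 0) N p); split.
- exact: Cn_bernstein.
- exact: (poly_before_bernstein (i := i)).
- by rewrite [s]splitr; apply: Cn_close_trans HN pf.
Qed.

Lemma Cn_close_dirds K n r f g js : Cn_close K n r f g -> (size js <= n)%N ->
  forall u, `|u| <= K -> `|dirds [seq e j | j <- js] f u - dirds [seq e j | j <-
    js] g u| <= r.
Proof.
elim: js n f g => [|j js IH] n f g; first by case: n => [|n] [].
by case: n => // n [_ /(_ j) H] /= sz; exact: IH H sz.
Qed.

Lemma dirds_basis_bound (h : U -> R) q (u : U) (B : R) : smooth h -> 0 <= B ->
  (forall js, size js = q -> `|dirds [seq e j | j <- js] h u| <= B) ->
  forall ws, size ws = q -> all small ws -> `|dirds ws h u| <= d%:R ^+ q * B.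
Proof.
move=> sh B0; elim: q h sh => [|q IH] h sh HB ws.
  by move=> /size0nil -> _; rewrite expr0 mul1r; apply: (HB [::]).
case: ws => // w ws [sw] /= /andP[w1 ws1].
rewrite {1}[w]rcoord_frame (dirds_suml (@rcoord_frame R d) (@rcoord_le R d)) //.
apply: le_trans (ler_norm_sum _ _ _) _.
rewrite exprS -mulrA mulr_natl -[X in _ *+ X]card_ord -sumr_const.
apply: ler_sum => j _; rewrite normrM.
apply: (@le_trans _ _ (1 * `|dirds ws (dird (e j) h) u|)).
  by apply: ler_wpM2r => //; exact: le_trans (rcoord_le _ _) w1.
rewrite mul1r; apply: IH => //; first exact: smooth_dird.
by move=> js sj; apply: (HB (j :: js)); rewrite /= sj.
Qed.

End PolynomialApproximation.

(** * The theorem *)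

Section Diagonal.
Context (R : realType) (d : nat).
Local Notation S := (symmx R d).
Local Notation M := 'M[R]_d.
Local Notation U := 'rV[R]_d.

Fact diagS_diag (u : U) : diag_pred (diagS u).
Proof. by rewrite /diag_pred symval_diagS diag_mx_is_diag. Qed.

Definition diagD (u : U) : diagmx R d := DiagMx (diagS_diag u).

Fact diagD_linear : linear diagD.
Proof. by move=> a u v; apply: val_inj; exact: linearP. Qed.

HB.instance Definition _ :=
  GRing.isLinear.Build R U (diagmx R d) _ diagD diagD_linear.

Lemma diagD_continuous : continuous diagD.
Proof.
apply: (@linear_le_continuous _ _ _ (diagD : {linear U -> diagmx R d}) 1) => u.
by rewrite mul1r; exact: diagS_le.
Qed.

Lemma Cn_diagS n (F : S -> R) : Cn n (fun x : diagmx R d => F (diagval x)) ->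
  Cn n (fun u : U => F (diagS u)).
Proof.
apply: (Cn_affine (A := diagD) (L := diagD) diagD_continuous).
exact: linearD.
Qed.

Fact permr_linear (s : 'S_d) : linear (col_perm s : U -> U).
Proof. by move=> a u v; apply/rowP => k; rewrite !mxE. Qed.

Definition permr (s : 'S_d) (u : U) : U := col_perm s u.

HB.instance Definition _ (s : 'S_d) :=
  GRing.isLinear.Build R U U _ (permr s) (permr_linear s).

Lemma permr_le s u : `|permr s u| <= `|u|.
Proof. by apply: mx_norm_leP => // i j; rewrite mxE; exact: mx_entry_le. Qed.

Lemma permr_continuous s : continuous (permr s).
Proof.
apply: (@linear_le_continuous _ _ _ (permr s : {linear U -> U}) 1) => u.
by rewrite mul1r permr_le.
Qed.

Lemma rotation_invariant_perm (F : S -> R) (s : 'S_d) (u : U) : (0 < d)%N ->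
  rotation_invariant F -> F (diagS (permr s u)) = F (diagS u).
Proof.
move=> d0 iF; pose i0 := Ordinal d0.
(* E corrects the determinant of the permutation matrix. *)
pose E : M := diag_mx (\row_k (if k == i0 then (-1) ^+ s else 1)).
pose g : M := E *m perm_mx s.
have EE : E *m E = 1%:M.
  rewrite /E mulmx_diag -diag_const_mx; congr diag_mx; apply/rowP => k;
    rewrite !mxE.
  by case: ifP => _; rewrite ?mulr1 // -expr2 sqrr_sign.
have ET : E^T = E by rewrite tr_diag_mx.
have PP : perm_mx s *m (perm_mx s)^T = 1%:M :> M.
  by rewrite tr_perm_mx -perm_mxM mulgV perm_mx1.
have hg : is_rotation g.
  apply/andP; split; apply/eqP.
    by rewrite /g trmx_mul ET mulmxA -(mulmxA E) PP mulmx1.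
  rewrite /g det_mulmx det_perm det_diag (bigD1 i0) //= !mxE eqxx big1.
    by rewrite mulr1 -expr2 sqrr_sign.
  by move=> k /negbTE ki; rewrite mxE ki.
rewrite -(iF (diagS u) g hg); congr F; apply: val_inj.
rewrite [LHS]symval_diagS [RHS]sym_conjE symval_diagS /g trmx_mul ET.
have -> : E *m perm_mx s *m diag_mx u *m ((perm_mx s)^T *m E) =
    E *m (perm_mx s *m diag_mx u *m (perm_mx s)^T) *m E.
  by rewrite !mulmxA.
have -> : perm_mx s *m diag_mx u *m (perm_mx s)^T = diag_mx (permr s u).
  rewrite tr_perm_mx -row_permE -col_permE; apply/matrixP => i j.
  by rewrite !mxE (inj_eq perm_inj).
(* The sign correction is invisible after conjugation: E commutes with diagonal matrices and squares
   to 1. *)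
by rewrite /E diag_mxC -mulmxA -/E EE mulmx1.
Qed.

Local Notation card_perms := (#|{perm 'I_d}|%:R : R).

Let card_perms_gt0 : 0 < card_perms.
Proof. by rewrite ltr0n; apply/card_gt0P; exists 1%g. Qed.

Lemma mean_bound (a : 'S_d -> R) (B : R) : (forall s, `|a s| <= B) ->
  `|card_perms^-1 * \sum_s a s| <= B.
Proof.
move=> H; rewrite normrM normfV (gtr0_norm card_perms_gt0) mulrC.
rewrite ler_pdivrMr //; apply: le_trans (ler_norm_sum _ _ _) _.
by rewrite mulr_natr -sumr_const; apply: ler_sum => s _.
Qed.

Definition symmetrize_fun (p : U -> R) (u : U) : R :=
  card_perms^-1 * \sum_(s : 'S_d) p (permr s u).

Lemma symmetrize_fun_dist (p f : U -> R) u : (forall s, f (permr s u) = f u) ->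
  symmetrize_fun p u - f u = card_perms^-1 * \sum_s (p (permr s u) - f (permr s
    u)).
Proof.
move=> fs; rewrite sumrB mulrBr; congr (_ - _).
under eq_bigr => s _ do rewrite fs.
rewrite sumr_const -[f u *+ _]mulr_natl mulKf //.
by rewrite (gt_eqF card_perms_gt0).
Qed.

Lemma smooth_polyfun (p : U -> R) : polyfun p -> smooth p.
Proof.
elim=> {p} [c|i|f g _ sf _ sg|f g _ sf _ sg].
- exact: smooth_cst.
- exact: smooth_rcoord.
- exact: smoothD.
- exact: smoothM.
Qed.

Lemma dirds_symmetrize (p : U -> R) ws u : smooth p ->
  dirds ws (symmetrize_fun p) u =
  card_perms^-1 * \sum_s dirds (map (permr s) ws) p (permr s u).
Proof.
move=> sp; have sps s : smooth (fun u => p (permr s u)).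
  exact: (smooth_lincomp (@permr_continuous s) sp).
rewrite /symmetrize_fun dirdsZ; last by apply: smooth_sum => s _.
congr (_ * _).
have DS (h : 'S_d -> U -> R) : (forall s, smooth (h s)) ->
    dirds ws (fun u => \sum_s h s u) = fun u => \sum_s dirds ws (h s) u.
  elim: ws h => //= w ws IH h sh; rewrite dird_sum.
    by rewrite IH // => s; apply: smooth_dird.
  by move=> s _; apply: smooth_diffable.
rewrite (DS (fun s u => p (permr s u)) sps); apply: eq_bigr => s _.
by rewrite (dirds_lincomp (@permr_continuous s)).
Qed.

(** * Cauchy property of the invariant extensions *)

Section Cauchy.
Variables (n : nat) (f : U -> R) (p : nat -> U -> R) (P : nat -> S -> R).
Hypothesis sp : forall N, smooth (p N).
(** Radius and precision improve together, so that a single sequence converges on every bounded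
    set. *)
Hypothesis pf : forall N, Cn_close N.+1%:R n N.+1%:R^-1 (p N) f.
Hypothesis sP : forall N, smooth (P N).
Hypothesis iP : forall N, rotation_invariant (P N).
Hypothesis PE : forall N u, P N (diagS u) = symmetrize_fun (p N) u.

Lemma dirds_difference_bound (js : seq 'I_d) (N0 N N' : nat) (u : U) :
  (size js <= n)%N -> (N0 <= N)%N -> (N0 <= N')%N -> `|u| <= N0%:R ->
  `|dirds [seq delta_mx 0 j | j <- js] (fun u => p N u + (-1) * p N' u) u| <=
  2 / N0.+1%:R.
Proof.
move=> sj N0N N0N' uN; rewrite dirdsD // ?dirdsZ //; last exact: smoothZ.
have A m : (N0 <= m)%N ->
    `|dirds [seq delta_mx 0 j | j <- js] (p m) u -
      dirds [seq delta_mx 0 j | j <- js] f u| <= N0.+1%:R^-1.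
  move=> N0m; apply: le_trans (Cn_close_dirds (pf m) sj _) _.
    by apply: le_trans uN _; rewrite ler_nat ltnW.
  by rewrite lef_pV2 ?posrE ?ltr0n // ler_nat.
rewrite mulN1r; apply: le_trans (ler_distD (dirds [seq delta_mx 0 j | j <- js] f
  u) _ _) _.
have A2 := A N' N0N'; rewrite distrC in A2.
apply: le_trans (lerD (A N N0N) A2) _.
by rewrite -[X in X <= _]mulr2n -[X in X <= _]mulr_natl.
Qed.

Lemma ucauchy_lifts vs : (size vs <= n)%N -> ucauchy (fun N => dirds vs (P N)).
Proof.
move=> sz K r r0.
(* A positive common bound for the directions, by which they are rescaled into the unit ball. *)
pose t : R := 1 + \sum_(v <- vs) `|v|.
have t0 : 0 < t by rewrite ltr_wpDr // sumr_ge0.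
pose ws := [seq t^-1 *: v | v <- vs].
have wsE : vs = [seq t *: w | w <- ws].
  rewrite /ws -map_comp -[LHS]map_id; apply: eq_map => v /=.
  by rewrite scalerA divff ?gt_eqF // scale1r.
have sw : size ws = size vs by rewrite size_map.
have ws1 : all (fun v => `|v| <= 1) ws.
  apply/allP => _ /mapP[v vvs ->].
  rewrite normrZ normfV (gtr0_norm t0) mulrC ler_pdivrMr // mul1r.
  by rewrite /t (big_rem v) //= addrCA lerDl addr_ge0 // sumr_ge0.
have [C C0 HC] := invariant_estimate R d (size vs).
(* The factors come from the rescaling, [invariant_estimate], the expansion in [dirds_basis_bound],
   and the triangle inequality through f. *)
pose Z := t ^+ size vs * (C * (d%:R ^+ size vs * 2)).
(* The first condition makes Z / (N0 + 1) at most r; the second puts the enlarged cube of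
   [invariant_estimate] where [p N] and [p N'] approximate f. *)
have [N0 [ZN KN]] : exists N0 : nat,
  Z / r <= N0%:R /\ ((d * d)%:R + 1) * K <= N0%:R.
  by near \oo => N0; exists N0; split; near: N0; exact: nbhs_infty_ger.
exists N0 => N N' N0N N0N' x xK.
pose Q x := P N x + (-1) * P N' x.
have sQ : smooth Q by apply: smoothD => //; apply: smoothZ.
have iQ : rotation_invariant Q by move=> y g hg; rewrite /Q !iP.
have -> : dirds vs (P N) x - dirds vs (P N') x = t ^+ size vs * dirds ws Q x.
  have -> : t ^+ size vs * dirds ws Q x = dirds vs Q x.
    by rewrite {2}wsE dirds_scale // sw.
  rewrite /Q dirdsD //; last exact: smoothZ.
  by rewrite dirdsZ // mulN1r.
have A0 : 0 <= d%:R ^+ size vs * (2 / N0.+1%:R) :> R.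
  by rewrite mulr_ge0 // ?exprn_ge0 // divr_ge0.
have := HC Q K _ sQ iQ A0 _ ws sw ws1 x xK => H.
rewrite normrM (ger0_norm (exprn_ge0 _ (ltW t0))).
apply: le_trans (ler_wpM2l (exprn_ge0 _ (ltW t0)) (H _)) _; last first.
  have -> : t ^+ size vs * (C * (d%:R ^+ size vs * (2 / N0.+1%:R))) = Z /
    N0.+1%:R.
    by rewrite /Z !mulrA.
  rewrite ler_pdivrMr ?ltr0n // mulrC -ler_pdivrMr //.
  by apply: le_trans ZN _; rewrite ler_nat.
move=> vs' sz' vs1 u uK.
rewrite -[dirds _ Q _](congr1 (fun f =>
  f u) (dirds_lincomp (@diagS_continuous R d) vs' sQ)).
have -> : (fun u => Q (diagS u)) = symmetrize_fun (fun u =>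
  p N u + (-1) * p N' u).
  apply/funext => v; rewrite /Q !PE /symmetrize_fun mulN1r -mulrBr -sumrB.
  by congr (_ * _); apply: eq_bigr => s _; rewrite mulN1r.
have sh : smooth (fun u => p N u + (-1) * p N' u).
  by apply: smoothD => //; apply: smoothZ.
rewrite dirds_symmetrize //; apply: mean_bound => s.
apply: (dirds_basis_bound sh).
- by rewrite divr_ge0.
- move=> js sj; apply: dirds_difference_bound => //; first by rewrite sj.
  by apply: le_trans (permr_le _ _) _; apply: le_trans uK KN.
- by rewrite size_map.
- rewrite all_map; apply: sub_all vs1 => v /= v1.
  exact: le_trans (permr_le _ _) v1.
Unshelve. all: by end_near. Qed.

End Cauchy.

End Diagonal.

Theorem theorem2 (R : realType) (d n : nat) (hd : (1 <= d)%N)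
    (F : symmx R d -> R) (hF : rotation_invariant F)
    (hD : Cn n (fun x : diagmx R d => F (diagval x))) :
  Cn n F.
Proof.
pose f (u : 'rV[R]_d) := F (diagS u).
have cf : Cn n f by exact: Cn_diagS hD.
have fs s u : f (permr s u) = f u by exact: rotation_invariant_perm.
have /choice[p Hp] : forall N : nat, exists p : 'rV[R]_d -> R, polyfun p /\
    Cn_close N.+1%:R n N.+1%:R^-1 p f.
  move=> N; have K0 : 0 < N.+1%:R :> R by rewrite ltr0n.
  have r0 : 0 < N.+1%:R^-1 :> R by rewrite invr_gt0.
  by have [p pp pf] := polynomial_approximation cf K0 r0; exists p.
have /choice[P HP] : forall N, exists P : symmx R d -> R,
  [/\ smooth P, rotation_invariant P &
      forall u, P (diagS u) = symmetrize_fun (p N) u].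
  move=> N; have [P [sP iP PE]] := polyfun_lift (Hp N).1.
  (* Dividing by the number of permutations turns the sum into a mean, which preserves the symmetric
     f and does not amplify the error. *)
  exists (fun x => #|{perm 'I_d}|%:R^-1 * P x); split.
  - exact: smoothZ.
  - by move=> x g hg; rewrite iP.
  - by move=> u; rewrite PE.
apply: (limit_Cn (@scoord_frame R d) (@scoord_le R d) (g := P)).
- by move=> N; have [sP _ _] := HP N; apply: sP.
- apply: (@ucauchy_lifts _ _ n f p P) => N;
  first exact: smooth_polyfun (Hp N).1.
  + exact: (Hp N).2.
  + by have [] := HP N.
  + by have [] := HP N.
  + by have [] := HP N.
(* Both [F] and [P N] are invariant, so the limit needs checking only at a diagonal matrix, where
   [P N] is the mean of [p N] over permutations and f is symmetric. *)
move=> x; have [g [hg [u [xu ux]]]] := rotation_to_diagS x.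
have -> : F x = f u by rewrite /f -xu hF.
have -> : P ^~ x = fun N => symmetrize_fun (p N) u.
  by apply/funext => N; have [_ iP PE] := HP N; rewrite -PE -xu iP.
apply/cvgrPdist_le => r r0; near=> N; rewrite distrC.
rewrite symmetrize_fun_dist //; apply: mean_bound => s.
have Nr : N.+1%:R^-1 <= r.
  near: N; have /cvgrPdist_le/(_ _ r0) := @cvg_harmonic R.
  by apply: filterS => N; rewrite sub0r normrN ger0_norm // invr_ge0.
apply: le_trans Nr; have [pp pf] := Hp N.
apply: (Cn_close_dirds (js := [::]) pf) => //.
apply: le_trans (permr_le _ _) _.
have uN : `|u| <= N%:R by near: N; exact: nbhs_infty_ger.
by apply: le_trans uN _; rewrite ler_nat.
Unshelve. all: by end_near. Qed.
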